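(* Let $G$ be a Lie group with Lie algebra $\mathfrak g$ and let $\mathcal D=\mathfrak g\ltimes\mathfrak g^*$ be the Lie algebra of $T^*G$. The first cohomology space $H^1(\mathcal D,\mathcal D)$ of the Chevalley-Eilenberg cohomology associated with the adjoint action of $\mathcal D$ on itself satisfies $$H^1(\mathcal D,\mathcal D)\cong H^1(\mathfrak g,\mathfrak g)\oplus\mathcal J^t\oplus H^1(\mathfrak g,\mathfrak g^* )\oplus\Psi,$$ where $H^1(\mathfrak g,\mathfrak g)$ and $H^1(\mathfrak g,\mathfrak g^* )$ are the first cohomology spaces associated with the adjoint and coadjoint actions of $\mathfrak g$ respectively. If $\mathfrak g$ is semi-simple, then $\Psi=\{0\}$ and thus $H^1(\mathcal D,\mathcal D)\cong\mathcal J^t$. Moreover $\mathcal J\cong\mathbb R^p$, where $p$ is the number of simple ideals $\mathfrak s_i$ of $\mathfrak g$ such that $\mathfrak g=\mathfrak s_1\oplus\cdots\oplus\mathfrak s_p$; hence $H^1(\mathcal D,\mathcal D)\cong\mathbb R^p$. If $\mathfrak g$ is a compact Lie algebra with centre $Z(\mathfrak g)$, then $$H^1(\mathfrak g,\mathfrak g)\cong \mathrm{End}(Z(\mathfrak g)),\quad \mathcal J\cong\mathbb R^p\oplus \mathrm{End}(Z(\mathfrak g)),\quad H^1(\mathfrak g,\mathfrak g^* )\cong L(Z(\mathfrak g),Z(\mathfrak g)^* ),\quad \Psi\cong L(Z(\mathfrak g)^*,Z(\mathfrak g)),$$ and hence $H^1(\mathcal D,\mathcal D)\cong(\mathrm{End}(\mathbb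 R^k))^4\oplus\mathbb R^p$, where $k$ is the dimension of the centre of $\mathfrak g$ and $p$ is the number of simple components of the derived ideal $[\mathfrak g,\mathfrak g]$.
   Context: Lie groups and Lie algebras are real and finite dimensional; isomorphisms are of vector spaces. $ad^*_xf=-f\circ ad_x$ for $x\in\mathfrak g$, $f\in\mathfrak g^*$. $T^*G$ has the Lie group structure $G\ltimes\mathfrak g^*$ (coadjoint action), and $\mathcal D=\mathfrak g\ltimes\mathfrak g^*$ has bracket $[(x,f),(y,g)]=([x,y],\,ad^*_xg-ad^*_yf)$. $\mathcal J$ is the space of linear maps $j:\mathfrak g\to\mathfrak g$ with $j([x,y])=[j(x),y]$ for all $x,y$, and $\mathcal J^t=\{j^t: j\in\mathcal J\}$ is the space of transposes of its elements. $\Psi$ is the space of linear maps $\psi:\mathfrak g^*\to\mathfrak g$ with $\psi\circ ad^*_x=ad_x\circ\psi$ and $ad^*_{\psi(f)}g=ad^*_{\psi(g)}f$ for all $x\in\mathfrak g$, $f,g\in\mathfrak g^*$. For vector spaces $E,F$, $L(E,F)$ is the space of linear maps $E\to F$. A compact Lie algebra $\mathfrak g$ decomposes as $\mathfrak g=[\mathfrak g,\mathfrak g]\oplus Z(\mathfrak g)$ with $[\mathfrak g,\mathfrak g]$ semi-simple and compact.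
   Formalization: For semi-simple g, the claims J ≅ R^p and H^1(D,D) ≅ R^p are proved assuming that no simple ideal s_i is a complex Lie algebra viewed as real; without this they fail, e.g. for sl_2(C) as a real algebra, where p = 1 but dim J = 2. *)

(* Defs.v *)
From HB Require Import structures.
From mathcomp Require Import all_boot all_order all_algebra.
From mathcomp Require Import boolp classical_sets reals.

Set Implicit Arguments.
Unset Strict Implicit.
Unset Printing Implicit Defensive.

Import Order.TTheory GRing.Theory Num.Theory.
Local Open Scope ring_scope.
Local Open Scope quotient_scope.

Definition dualv (F : fieldType) (V : vectType F) : vectType F := 'Hom(V, F^o).

Definition vs_iso (F : fieldType) (V W : vectType F) : Prop :=
  exists f : 'Hom(V, W), bijective f.

Notation "V ≅ W" := (vs_iso V W) (at level 70, no associativity).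

Lemma linfunE (F : fieldType) (V W : vectType F) (f : V -> W) :
  linear f -> linfun f =1 f.
Proof.
move=> lin; pose h := HB.pack_for {linear V -> W} f
  (GRing.isLinear.Build F V W _ f lin).
by move=> v; rewrite -[f]/(h : V -> W) lfunE.
Qed.

Section VspaceOf.
Variables (F : fieldType) (V : vectType F).

(* The subspace whose elements are the v with P v; the junk value 0 if these
   do not form a subspace. Each use below comes with its membership lemma. *)
Definition vspace_of (P : V -> Prop) : {vspace V} :=
  xget 0%VS (fun U : {vspace V} => forall v, v \in U <-> P v).

Lemma mem_vspace_of (P : V -> Prop) :
  P 0 -> (forall a u v, P u -> P v -> P (a *: u + v)) ->
  forall v, v \in vspace_of P <-> P v.
Proof.
move=> P0 Plin.
suff exU : exists U : {vspace V}, forall v, v \in U <-> P v.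
  by rewrite /vspace_of; case: xgetP => [U _ // | noU]; case: exU => U /noU.
pose D := [pred n | `[< exists2 U : {vspace V}, \dim U = n &
                       forall v, v \in U -> P v >]].
have exD : exists n, D n.
  exists 0%N; apply/asboolP; exists 0%VS; first by rewrite dimv0.
  by move=> v; rewrite memv0 => /eqP->.
have Dle n : D n -> (n <= \dim {:V})%N.
  by move=> /asboolP[U <- _]; exact/dimvS/subvf.
case: (ex_maxnP exD Dle) => n /asboolP[U dimU UP] maxn.
exists U => v; split=> [|Pv]; first exact: UP.
suff /maxn : D (\dim (<[v]> + U)).
  rewrite -dimU => leq; have := dimv_leqif_sup (addvSr <[v]> U).
  case=> _ /esym; rewrite eqn_leq leq dimvS ?addvSr // => sub.
  by apply: (subvP sub); rewrite memvE addvSl.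
apply/asboolP; exists (<[v]> + U)%VS => //.
by move=> _ /memv_addP[_ /vlineP[a ->] [u Uu ->]]; apply: Plin => //; exact: UP.
Qed.

End VspaceOf.

Section QuotientSpace.
Import VectorInternalTheory.
Variables (F : fieldType) (V : vectType F) (U : {vspace V}).

Definition quotv := Quotient.quot U.
HB.instance Definition _ := EqQuotient.on quotv.
HB.instance Definition _ := GRing.Zmodule.on quotv.

Lemma quotvE (u v : V) : (\pi_quotv u = \pi_quotv v) <-> u - v \in U.
Proof. by rewrite (Quotient.idealrBE U); split=> [->|/eqP]. Qed.

Definition quotv_scale (a : F) (q : quotv) : quotv := \pi_quotv (a *: repr q).

Lemma quotv_scale_pi a v : quotv_scale a (\pi_quotv v) = \pi_quotv (a *: v).
Proof.
by apply/quotvE; rewrite -scalerBr memvZ //; apply/quotvE; rewrite reprK.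
Qed.

Lemma quotvD u v : \pi_quotv (u + v) = \pi_quotv u + \pi_quotv v.
Proof. exact: (Quotient.pi_add U). Qed.

Fact quotv_scaleA a b q :
  quotv_scale a (quotv_scale b q) = quotv_scale (a * b) q.
Proof. by elim/quotW: q => v; rewrite [quotv_scale b _]quotv_scale_pi !quotv_scale_pi scalerA. Qed.
Fact quotv_scale1 : left_id 1 quotv_scale.
Proof. by elim/quotW => v; rewrite quotv_scale_pi scale1r. Qed.
Fact quotv_scaleDr : right_distributive quotv_scale +%R.
Proof.
move=> a; elim/quotW => u; elim/quotW => v.
by rewrite -quotvD !quotv_scale_pi scalerDr quotvD.
Qed.
Fact quotv_scaleDl q : {morph quotv_scale^~ q : a b / a + b}.
Proof.
by move=> a b; elim/quotW: q => v; rewrite !quotv_scale_pi scalerDl quotvD.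
Qed.

HB.instance Definition _ := GRing.Zmodule_isLmodule.Build F quotv
  quotv_scaleA quotv_scale1 quotv_scaleDr quotv_scaleDl.

Fact pi_quotv_linear : linear \pi_quotv.
Proof. by move=> a u v; rewrite quotvD -quotv_scale_pi. Qed.

Fact quotv_vect_iso : Vector.axiom (dim (subvs_of U^C)) quotv.
Proof.
pose h (w : 'rV_(dim (subvs_of U^C))) : quotv := \pi_quotv (vsval (r2v w)).
have h_lin : linear h.
  by move=> a u v; rewrite /h !linearP /= pi_quotv_linear.
pose hL := HB.pack_for {linear 'rV_(dim (subvs_of U^C)) -> quotv} h
  (GRing.isLinear.Build F _ _ _ h h_lin).
pose k (q : quotv) : 'rV_(dim (subvs_of U^C)) :=
  v2r (vsproj U^C (daddv_pi U^C U (repr q))).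
have capC : (U^C :&: U = 0)%VS by rewrite capvC; exact: capv_compl.
have capC' : (U :&: U^C = 0)%VS by exact: capv_compl.
have hK : cancel h k.
  move=> w; rewrite /k /h; set u := r2v w.
  rewrite -[RHS](r2vK w) -/u; congr v2r; apply: val_inj.
  rewrite /= vsprojK ?memv_pi //.
  have : repr (\pi_quotv (vsval u)) - vsval u \in U.
    by apply/quotvE; rewrite reprK.
  set r := repr _; move=> rU.
  rewrite -[r](subrK (vsval u)) linearD /= [daddv_pi _ _ (vsval u)]daddv_pi_id ?subvsP //.
  suff -> : daddv_pi U^C U (r - vsval u) = 0 by rewrite add0r.
  apply: (addIr (r - vsval u)); rewrite add0r -{2}[r - _](daddv_pi_id capC') //.
  by rewrite daddv_pi_add // addvC addv_complf memvf.
have kK : cancel k h.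
  move=> q; rewrite /h /k v2rK vsprojK ?memv_pi //.
  rewrite -[RHS]reprK; apply/quotvE.
  rewrite -{2}[repr q](daddv_pi_add (V := U) capC) ?[(_^C + _)%VS]addvC.
    by rewrite opprD addrA subrr sub0r memvN memv_pi.
  by rewrite addv_complf memvf.
exists k; last by exists h.
exact: (can2_linear (f := hL) hK kK).
Qed.

HB.instance Definition _ := Lmodule_hasFinDim.Build F quotv quotv_vect_iso.

End QuotientSpace.

HB.mixin Record Vector_isLieAlgebra (F : fieldType) (g : Type)
    of Vector F g := {
  bracket : g -> g -> g;
  bracket_linearl : forall y, linear (bracket^~ y);
  bracket_linearr : forall x, linear (bracket x);
  bracketxx : forall x, bracket x x = 0;
  jacobi : forall x y z,
    bracket x (bracket y z) + bracket y (bracket z x)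
      + bracket z (bracket x y) = 0
}.

#[short(type="lieAlgType")]
HB.structure Definition LieAlgebra (F : fieldType) :=
  {g of Vector_isLieAlgebra F g & Vector F g}.

Notation "⁅ x , y ⁆" := (bracket x y) (at level 0, x, y at level 200).

Section LieTheory.
Variables (F : fieldType) (g : lieAlgType F).
Implicit Types (x y z : g) (U V W I : {vspace g}).

HB.instance Definition _ x :=
  GRing.isLinear.Build F g g _ (bracket x) (bracket_linearr x).

Lemma bracketDl x y z : ⁅x + y, z⁆ = ⁅x, z⁆ + ⁅y, z⁆.
Proof. by have := bracket_linearl z 1 x y; rewrite !scale1r. Qed.
Lemma bracketDr x y z : ⁅x, y + z⁆ = ⁅x, y⁆ + ⁅x, z⁆.
Proof. exact: linearD. Qed.
Lemma bracket0l x : ⁅0, x⁆ = 0.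
Proof. by apply: (addrI ⁅0, x⁆); rewrite -bracketDl !addr0. Qed.
Lemma bracketZl a x y : ⁅a *: x, y⁆ = a *: ⁅x, y⁆.
Proof. by have := bracket_linearl y a x 0; rewrite bracket0l !addr0. Qed.
Lemma bracketZr a x y : ⁅x, a *: y⁆ = a *: ⁅x, y⁆.
Proof. exact: linearZ. Qed.

Lemma bracketC x y : ⁅x, y⁆ = - ⁅y, x⁆.
Proof.
have := bracketxx (x + y).
rewrite bracketDl !bracketDr !bracketxx add0r addr0 => /eqP.
by rewrite addr_eq0 => /eqP.
Qed.

Lemma bracketA x y z : ⁅⁅x, y⁆, z⁆ = ⁅x, ⁅y, z⁆⁆ - ⁅y, ⁅x, z⁆⁆.
Proof.
apply/eqP; rewrite -subr_eq0 (bracketC ⁅x, y⁆) (bracketC x z).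
rewrite [⁅y, - _⁆]linearN opprK -opprD oppr_eq0 addrC.
by rewrite jacobi.
Qed.

Definition center : {vspace g} := vspace_of (fun x => forall y, ⁅x, y⁆ = 0).

Lemma mem_center x : x \in center <-> forall y, ⁅x, y⁆ = 0.
Proof.
apply: mem_vspace_of => [y|a u v uP vP y]; first exact: bracket0l.
by rewrite bracketDl bracketZl uP vP scaler0 addr0.
Qed.

(* The span of the brackets of elements of U and V; by bilinearity it is
   enough to bracket basis vectors, as for the product of subspaces of an
   algebra in falgebra. *)
Definition lie_prod U V : {vspace g} :=
  <<[seq ⁅u, v⁆ | u <- vbasis U, v <- vbasis V]>>%VS.

Lemma mem_lie_prod U V x y : x \in U -> y \in V -> ⁅x, y⁆ \in lie_prod U V.
Proof.
move=> /coord_vbasis-> /coord_vbasis->.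
have -> : forall n (f : 'I_n -> g) v, ⁅\sum_i f i, v⁆ = \sum_i ⁅f i, v⁆.
  move=> n f v; elim/big_rec2: _ => [|i a b _ <-]; first exact: bracket0l.
  by rewrite bracketDl.
apply: memv_suml => i _; rewrite linear_sum; apply: memv_suml => j _.
rewrite /= bracketZl bracketZr memvZ // memvZ //.
apply: memv_span; apply: allpairs_f; exact/memt_nth.
Qed.

Lemma lie_prod_sub U V W :
  {in U & V, forall x y, ⁅x, y⁆ \in W} -> (lie_prod U V <= W)%VS.
Proof.
move=> UVW; apply/span_subvP => _ /allpairsP[[u v] /= [uU vV ->]].
by apply: UVW; exact: vbasis_mem.
Qed.

Definition solvable_lie U : Prop :=
  exists n, iter n (fun W => lie_prod W W) U = 0%VS.

Definition lie_ideal U I : Prop :=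
  (I <= U)%VS /\ {in U & I, forall x y, ⁅x, y⁆ \in I}.

Definition simple_lie U : Prop :=
  (exists2 x, x \in U & exists2 y, y \in U & ⁅x, y⁆ != 0)
  /\ forall I, lie_ideal U I -> I = 0%VS \/ I = U.

(* The radical of g is zero. *)
Definition semisimple : Prop :=
  forall I, lie_ideal fullv I -> solvable_lie I -> I = 0%VS.

Definition simple_decomp U (p : nat) (s : 'I_p -> {vspace g}) : Prop :=
  [/\ forall i, lie_ideal U (s i) /\ simple_lie (s i),
      (\sum_(i < p) s i)%VS = U & directv (\sum_(i < p) s i)].

(* U is the underlying algebra of a Lie algebra over F[i]: c is multiplication
   by the square root of -1. *)
Definition has_complex_structure U : Prop :=
  exists c : 'End(g),
    {in U, forall x, c x \in U /\ c (c x) = - x}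
    /\ {in U &, forall x y, c ⁅x, y⁆ = ⁅c x, y⁆}.

Definition Jspace : {vspace 'End(g)} :=
  vspace_of (fun j : 'End(g) => forall x y, j ⁅x, y⁆ = ⁅j x, y⁆).

Lemma mem_Jspace (j : 'End(g)) :
  j \in Jspace <-> forall x y, j ⁅x, y⁆ = ⁅j x, y⁆.
Proof.
apply: (@mem_vspace_of _ _ (fun j : 'End(g) => forall x y, j ⁅x, y⁆ = ⁅j x, y⁆)).
  by move=> x y; rewrite !lfunE /= bracket0l.
by move=> a u v uP vP x y; rewrite !lfunE /= !lfunE /= bracketDl bracketZl uP vP.
Qed.

Definition transpose (j : 'End(g)) : 'End(dualv g) :=
  linfun (fun f : dualv g => (f \o j)%VF).

Lemma transposeE (j : 'End(g)) (f : dualv g) x : transpose j f x = f (j x).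
Proof.
rewrite /transpose linfunE ?comp_lfunE // => a u v.
by rewrite comp_lfunDl comp_lfunZl.
Qed.

Definition Jtspace : {vspace 'End(dualv g)} :=
  vspace_of (fun k => exists2 j, j \in Jspace & k = transpose j).

Lemma mem_Jtspace k :
  k \in Jtspace <-> exists2 j, j \in Jspace & k = transpose j.
Proof.
apply: (@mem_vspace_of _ _ (fun k => exists2 j, j \in Jspace & k = transpose j)).
  exists 0; first exact: mem0v.
  by apply/lfunP => f; apply/lfunP => x; rewrite transposeE !zero_lfunE linear0.
move=> a _ _ [i iJ ->] [j jJ ->]; exists (a *: i + j); first by rewrite memvD ?memvZ.
apply/lfunP => f; apply/lfunP => x.
rewrite transposeE 2!add_lfunE 2!scale_lfunE !transposeE add_lfunE scale_lfunE.
by rewrite linearP.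
Qed.

Record lie_rep (V : vectType F) := LieRep {
  rep_act :> 'Hom(g, 'End(V));
  rep_bracket : forall x y v,
    rep_act ⁅x, y⁆ v = rep_act x (rep_act y v) - rep_act y (rep_act x v) }.

Definition ad : 'Hom(g, 'End(g)) := linfun (fun x => linfun (bracket x)).

Lemma adE x y : ad x y = ⁅x, y⁆.
Proof.
rewrite /ad linfunE ?lfunE // => a u v; apply/lfunP => w.
by rewrite lfunE add_lfunE scale_lfunE !lfunE /= bracketDl bracketZl.
Qed.

Definition coad : 'Hom(g, 'End(dualv g)) :=
  linfun (fun x => linfun (fun f : dualv g => - (f \o ad x)%VF)).

Lemma coadE x (f : dualv g) y : coad x f y = - f ⁅x, y⁆.
Proof.
have linE u (h : dualv g) z :
    linfun (fun f : dualv g => - (f \o ad u)%VF) h z = - h ⁅u, z⁆.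
  rewrite linfunE => [|a v w]; first by rewrite opp_lfunE comp_lfunE adE.
  by rewrite comp_lfunDl opprD scalerN comp_lfunZl.
rewrite /coad linfunE // => a v w; apply/lfunP => h; apply/lfunP => z.
rewrite add_lfunE scale_lfunE add_lfunE scale_lfunE !linE.
by rewrite bracketDl bracketZl linearP opprD scalerN.
Qed.

Fact ad_bracket x y v : ad ⁅x, y⁆ v = ad x (ad y v) - ad y (ad x v).
Proof. by rewrite !adE bracketA. Qed.
Definition ad_rep := LieRep ad_bracket.

Fact coad_bracket x y f :
  coad ⁅x, y⁆ f = coad x (coad y f) - coad y (coad x f).
Proof.
apply/lfunP => z; rewrite !lfunE /= !lfunE /= !coadE !opprK.
by rewrite bracketA linearB opprB.
Qed.
Definition coad_rep := LieRep coad_bracket.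

Definition Psispace : {vspace 'Hom(dualv g, g)} :=
  vspace_of (fun psi : 'Hom(dualv g, g) =>
    (forall x, psi \o coad x = ad x \o psi)%VF
    /\ forall f h, coad (psi f) h = coad (psi h) f).

Lemma mem_Psispace (psi : 'Hom(dualv g, g)) :
  psi \in Psispace <->
  (forall x, psi \o coad x = ad x \o psi)%VF
  /\ forall f h, coad (psi f) h = coad (psi h) f.
Proof.
apply: (@mem_vspace_of _ _ (fun psi : 'Hom(dualv g, g) =>
    (forall x, psi \o coad x = ad x \o psi)%VF
    /\ forall f h, coad (psi f) h = coad (psi h) f)).
  split=> [x|f h]; first by rewrite comp_lfun0l comp_lfun0r.
  by rewrite !lfunE /= !linear0 !lfunE.
move=> a u v [u1 u2] [v1 v2]; split=> [x|f h].
  by rewrite comp_lfunDl comp_lfunDr -comp_lfunZl u1 v1 comp_lfunZr.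
by rewrite !add_lfunE !scale_lfunE !linearP !add_lfunE !scale_lfunE u2 v2.
Qed.

Section Cohomology.
Variables (V : vectType F) (rho : lie_rep V).

(* Kernel of the Chevalley-Eilenberg differential Hom(g, V) -> Hom(Λ^2 g, V). *)
Definition cocycles1 : {vspace 'Hom(g, V)} :=
  vspace_of (fun c : 'Hom(g, V) =>
    forall x y, rho x (c y) - rho y (c x) - c ⁅x, y⁆ = 0).

Lemma mem_cocycles1 (c : 'Hom(g, V)) : c \in cocycles1 <->
  forall x y, rho x (c y) - rho y (c x) - c ⁅x, y⁆ = 0.
Proof.
apply: (@mem_vspace_of _ _ (fun c : 'Hom(g, V) =>
    forall x y, rho x (c y) - rho y (c x) - c ⁅x, y⁆ = 0)).
  by move=> x y; rewrite !zero_lfunE !linear0 !addr0.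
move=> a u v uP vP x y; rewrite !add_lfunE !scale_lfunE !linearP /=.
rewrite [X in X + _]addrACA [LHS]addrACA -2!scalerDr.
by rewrite uP vP scaler0 addr0.
Qed.

(* Image of the Chevalley-Eilenberg differential V -> Hom(g, V). *)
Definition coboundaries1 : {vspace 'Hom(g, V)} :=
  vspace_of (fun c : 'Hom(g, V) => exists v, forall x, c x = rho x v).

Lemma mem_coboundaries1 (c : 'Hom(g, V)) :
  c \in coboundaries1 <-> exists v, forall x, c x = rho x v.
Proof.
apply: (@mem_vspace_of _ _ (fun c : 'Hom(g, V) =>
                              exists v, forall x, c x = rho x v)).
  by exists 0 => x; rewrite zero_lfunE linear0.
move=> a b d [u uP] [v vP]; exists (a *: u + v) => x.
by rewrite add_lfunE scale_lfunE uP vP linearP.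
Qed.

Lemma coboundaries1_sub : (coboundaries1 <= cocycles1)%VS.
Proof.
apply/subvP => c /mem_coboundaries1[v cE]; apply/mem_cocycles1 => x y.
by rewrite !cE rep_bracket subrr.
Qed.

Definition H1 : vectType F :=
  quotv (linfun (@vsval _ _ cocycles1) @^-1: coboundaries1)%VS.

End Cohomology.
End LieTheory.

Arguments center {F} g.
Arguments semisimple {F} g.
Arguments Jspace {F} g.
Arguments Jtspace {F} g.
Arguments Psispace {F} g.
Arguments ad_rep {F} g.
Arguments coad_rep {F} g.

Section Cotangent.
Variables (F : fieldType) (g : lieAlgType F).

(* The semidirect product of g with its dual under the coadjoint action. *)
Definition cotangent_lie := (g * dualv g)%type.
HB.instance Definition _ := Vector.on cotangent_lie.

Definition cotangent_bracket (u v : cotangent_lie) : cotangent_lie :=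
  (⁅u.1, v.1⁆, coad g u.1 v.2 - coad g v.1 u.2).

Fact cotangent_linearr u : linear (cotangent_bracket u).
Proof.
move=> a v w; congr pair => /=; first by rewrite linearP.
rewrite !linearP add_lfunE scale_lfunE opprD addrACA; congr (_ + _).
by rewrite scalerBr.
Qed.

Fact cotangent_bracketC u v : cotangent_bracket u v = - cotangent_bracket v u.
Proof. by congr pair => /=; [exact: bracketC | rewrite opprB]. Qed.

Fact cotangent_linearl v : linear (cotangent_bracket^~ v).
Proof.
move=> a u w; rewrite !(cotangent_bracketC _ v) cotangent_linearr.
by rewrite opprD scalerN.
Qed.

Fact cotangent_bracketxx u : cotangent_bracket u u = 0.
Proof. by congr pair => /=; [exact: bracketxx | rewrite subrr]. Qed.

Fact cotangent_jacobi u v w :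
  cotangent_bracket u (cotangent_bracket v w)
    + cotangent_bracket v (cotangent_bracket w u)
    + cotangent_bracket w (cotangent_bracket u v) = 0.
Proof.
congr pair => /=; first exact: jacobi.
rewrite !coad_bracket !linearB /= !opprK !addrA.
rewrite (ACl ((1*11)*(2*8)*(3*5)*(4*10)*(6*12)*(7*9))) /=.
by rewrite !subrr !addNr !addr0.
Qed.

HB.instance Definition _ := Vector_isLieAlgebra.Build F cotangent_lie
  cotangent_linearl cotangent_linearr cotangent_bracketxx cotangent_jacobi.

End Cotangent.

Section Compact.
Variables (R : realType) (g : lieAlgType R).

(* g carries an inner product for which every ad x is skew-symmetric. *)
Definition compact_lie : Prop :=
  exists B : g -> g -> R,
    [/\ forall x, scalar (B x),
        forall x y, B x y = B y x,
        forall x, x != 0 -> 0 < B x x &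
        forall x y z, B ⁅x, y⁆ z + B y ⁅x, z⁆ = 0].

End Compact.

Arguments compact_lie {R} g.

(* Main.v *)
From HB Require Import structures.
Require Import Defs.
From mathcomp Require Import all_boot all_order all_algebra.
From mathcomp Require Import spectral complex.
From mathcomp Require Import reals boolp.

Set Implicit Arguments.
Unset Strict Implicit.
Unset Printing Implicit Defensive.

Import Order.TTheory GRing.Theory Num.Theory.
Local Open Scope ring_scope.

(** Every isomorphism claimed between finite dimensional spaces is an equality of
dimensions, and each dimension is computed by exhibiting an explicit linear map.

The cohomology of the cotangent algebra D. An operator on D is a 2 x 2 block matrix with
entries a : g -> g, b : g -> g', p : g' -> g and x : g' -> g', where g' is the dual of g.
Writing the derivation identity on pairs from g x g, g x g' and g' x g' uncouples the
blocks: a is a derivation of g, b a cocycle with values in g', p an element of Psi, and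
x + a^t commutes with the coadjoint action, i.e. lies in J^t ([block_cocycle]). For an
inner derivation, a and b are arbitrary coboundaries, and p = x + a^t = 0
([block_coboundary]).

Semisimple and compact algebras are treated together, through the property
[killing_reductive]: g is the direct sum of its centre Z and of S = [g, g], and the
radical of the Killing form is contained in Z. Then the Killing form represents every
functional vanishing on Z ([killing_surj]), so a derivation vanishing on Z is inner
([derivation_inner]), and H^1(g, g), H^1(g, g') and Psi all reduce to linear maps
between Z and its dual. The Killing form also splits S into simple ideals ([ideal_decomp]).
An element of the centroid J preserves each simple ideal; a complex eigenvalue of its
restriction makes it a real scalar there, unless the ideal is a complex Lie algebra
([centroid_scalar]). Hence dim J is the number of simple ideals plus (dim Z)^2
([dim_Jspace]).

For a compact algebra, ad x is skew-symmetric, so k(x, x) = tr (ad x)^2 is minus a sum of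
squares. This gives [killing_reductive], and it excludes complex structures, since
k(cx, cx) = - k(x, x) for a complex structure c.

For a semisimple algebra, what is needed is Cartan's criterion. A minimal ideal I inside
the radical of the Killing form is either abelian, which is excluded, or perfect. For
x in [I, I], let Y be the operator on the complexification of g equal to the conjugate
of a on the generalized eigenspace of ad x for a. By the Leibniz rule Y is a derivation,
so tr(ad [c, d] Y) = - tr(ad c ad (Y d)) = 0 for c in I; but tr(ad x Y) is the sum of the
|a|^2 counted with multiplicity ([conj_semisimple_part]), so ad x is nilpotent
([ad_nilpotent]). Engel's theorem ([engel]) then says that I is not perfect. *)

(** * Linear algebra *)

Section LinearAlgebra.
Import VectorInternalTheory.
Variables (F : fieldType) (V W : vectType F).
Implicit Types (U : {vspace V}).

Lemma vs_iso_dim : dim V = dim W -> V ≅ W.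
Proof.
move=> eVW.
pose c (u : 'rV[F]_(dim V)) : 'rV_(dim W) := castmx (erefl 1%N, eVW) u.
pose c' (u : 'rV[F]_(dim W)) : 'rV_(dim V) := castmx (esym (erefl 1%N), esym eVW) u.
have cK : cancel c c' by move=> u; rewrite /c /c' castmxK.
have cK' : cancel c' c by move=> u; rewrite /c /c' castmxKV.
pose f (v : V) : W := r2v (c (v2r v)).
pose f' (v : W) : V := r2v (c' (v2r v)).
have flin : linear f.
  have clin a x y : c (a *: x + y) = a *: c x + c y.
    by apply/rowP => i; rewrite /c !(castmxE, mxE).
  by move=> a u v; rewrite /f linearP clin linearP.
exists (linfun f); exists f' => v; rewrite linfunE // /f /f'.
  by rewrite r2vK cK v2rK.
by rewrite r2vK cK' v2rK.
Qed.

Lemma dim_ker_img (f : 'Hom(V, W)) U (B : {vspace V}) :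
    (B <= U)%VS -> {in U, forall u, f u = 0 <-> u \in B} ->
    (forall w, exists2 u, u \in U & f u = w) ->
  \dim U = (\dim B + dim W)%N.
Proof.
move=> sBU kerB surj; rewrite -(limg_ker_dim f U).
have -> : (U :&: lker f = B)%VS.
  apply/vspaceP => u; rewrite memv_cap memv_ker.
  apply/andP/idP => [[uU /eqP fu0]|uB]; first by apply/(kerB _ uU).
  by have uU := subvP sBU _ uB; split=> //; apply/eqP/(kerB _ uU).
congr addn; rewrite -dimvf; congr (\dim _); apply/vspaceP => w.
by rewrite memvf; have [u uU <-] := surj w; rewrite memv_img.
Qed.

Lemma dim_bij (f : 'Hom(V, W)) U :
    {in U, forall u, f u = 0 -> u = 0} ->
    (forall w, exists2 u, u \in U & f u = w) ->
  \dim U = dim W.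
Proof.
move=> inj surj; rewrite (@dim_ker_img f U 0) ?dimv0 ?sub0v // => u uU.
by rewrite memv0; split=> [/(inj u uU)->//|/eqP->]; rewrite linear0.
Qed.

Lemma dim_inj_img (f : 'Hom(V, W)) (U : {vspace W}) :
    (forall v, f v = 0 -> v = 0) ->
    (forall w, w \in U <-> exists v, f v = w) ->
  \dim U = dim V.
Proof.
move=> inj img; have -> : U = limg f.
  apply/vspaceP => w; apply/idP/memv_imgP => [/img[v <-]|[v _ ->]].
    by exists v; rewrite ?memvf.
  by apply/img; exists v.
rewrite limg_dim_eq ?dimvf //; apply/eqP; rewrite capfv -subv0.
by apply/subvP => v; rewrite memv_ker memv0 => /eqP/inj->.
Qed.

End LinearAlgebra.

Lemma dim_quotv (F : fieldType) (V : vectType F) (U : {vspace V}) :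
  dim (quotv U) = (dim V - \dim U)%N.
Proof. by rewrite -dimvf -dimv_compl. Qed.

Lemma dimH1 (F : fieldType) (g : lieAlgType F) (V : vectType F) (rho : lie_rep g V) :
  (\dim (coboundaries1 rho) + dim (H1 rho))%N = \dim (cocycles1 rho).
Proof.
rewrite /H1 dim_quotv /=.
set i := linfun _; have iE x : i x = vsval x by rewrite /i lfunE.
have -> : \dim (i @^-1: coboundaries1 rho) = \dim (coboundaries1 rho).
  rewrite -[in RHS](@lpreimK _ _ _ i (coboundaries1 rho)).
    rewrite limg_dim_eq //; apply/eqP; rewrite -subv0; apply/subvP => v.
    by rewrite memv_cap memv_ker memv0 iE => /andP[_ /eqP v0]; apply/eqP/val_inj.
  apply/subvP => c /(subvP (coboundaries1_sub rho)) cZ; apply/memv_imgP.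
  by exists (Subvs cZ); rewrite ?memvf ?iE.
by rewrite subnKC // dimvS // coboundaries1_sub.
Qed.

Lemma dimH1_eq (F : fieldType) (g : lieAlgType F) (V W : vectType F) (rho : lie_rep g V)
    (f : 'Hom('Hom(g, V), W)) :
    {in cocycles1 rho, forall c, f c = 0 <-> c \in coboundaries1 rho} ->
    (forall w, exists2 c, c \in cocycles1 rho & f c = w) ->
  dim (H1 rho) = dim W.
Proof.
move=> kerf surj; apply: (@addnI (\dim (coboundaries1 rho))); rewrite dimH1.
by apply: dim_ker_img kerf surj; apply: coboundaries1_sub.
Qed.

Section Trace.
Variables (F : fieldType) (V : vectType F).
Let e := vbasis (@fullv F V).

(** The trace in one fixed basis; [lftrace_rank1] makes it independent of that choice. *)
Definition lftrace (f : 'End(V)) : F := \sum_i coord e i (f e`_i).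

Lemma lftrace_linear : scalar lftrace.
Proof.
move=> a f h; rewrite /lftrace mulr_sumr -big_split /=; apply: eq_bigr => i _.
by rewrite add_lfunE scale_lfunE linearP.
Qed.
HB.instance Definition _ := GRing.isLinear.Build F 'End(V) F _ lftrace lftrace_linear.


Lemma coord_full v : v = \sum_i coord e i v *: e`_i.
Proof. exact/coord_vbasis/memvf. Qed.

Lemma lftrace_comp (f h : 'End(V)) : lftrace (f \o h) = lftrace (h \o f).
Proof.
have E (p q : 'End(V)) : lftrace (p \o q) =
    \sum_(i < \dim {:V}) \sum_(j < \dim {:V}) coord e j (q e`_i) * coord e i (p e`_j).
  apply: eq_bigr => i _; rewrite comp_lfunE {1}(coord_full (q e`_i)) !linear_sum.
  by apply: eq_bigr => j _; rewrite !linearZ.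
rewrite !E exchange_big; apply: eq_bigr => i _; apply: eq_bigr => j _.
exact: mulrC.
Qed.

Lemma lftrace_rank1 (f : 'Hom(V, F^o)) w (h : 'End(V)) :
  (forall v, h v = f v *: w) -> lftrace h = f w.
Proof.
move=> hE; rewrite (coord_full w) linear_sum; apply: eq_bigr => i _.
by rewrite hE !linearZ /= mulrC.
Qed.

End Trace.

(** * The cohomology of the cotangent algebra *)

Section Duality.
Variables (F : fieldType) (V : vectType F).

Lemma dual_sep (u v : V) : (forall f : dualv V, f u = f v) -> u = v.
Proof.
move=> E; rewrite (coord_full u) (coord_full v); apply: eq_bigr => i _.
by have := E (linfun (coord (vbasis fullv) i : V -> F^o)); rewrite !lfunE /= => ->.
Qed.

Lemma dim_dual : dim (dualv V) = dim V.
Proof. by rewrite /dim /= muln1. Qed.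

End Duality.

(** A finite dimensional space is reflexive: j is recovered from the images under k of
    the dual basis. *)
Lemma transpose_surj (F : fieldType) (g : lieAlgType F) (k : 'End(dualv g)) :
  exists j : 'End(g), k = transpose j.
Proof.
pose e := vbasis (@fullv F g).
pose de i : dualv g := linfun (coord e i : g -> F^o).
pose j := linfun (fun v : g => \sum_(i < \dim {:g}) k (de i) v *: e`_i).
have jE v : j v = \sum_(i < \dim {:g}) k (de i) v *: e`_i.
  rewrite /j linfunE // => a u w; rewrite scaler_sumr -big_split /=.
  by apply: eq_bigr => i _; rewrite linearP scalerDl scalerA.
exists j; apply/lfunP => f; apply/lfunP => v; rewrite transposeE jE linear_sum.
have fE : f = \sum_(i < \dim {:g}) f e`_i *: de i.
  apply/lfunP => w; rewrite sum_lfunE [in LHS](coord_full w) linear_sum.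
  by apply: eq_bigr => i _; rewrite scale_lfunE lfunE linearZ; exact: mulrC.
rewrite [in LHS]fE [in LHS]linear_sum sum_lfunE; apply: eq_bigr => i _.
by rewrite !linearZ scale_lfunE; exact: mulrC.
Qed.

Section Cotangent.
Variables (F : fieldType) (g : lieAlgType F).
Local Notation D := (cotangent_lie g).

Lemma transpose_linear : linear (@transpose F g).
Proof.
move=> a i j; apply/lfunP => f; apply/lfunP => x.
rewrite transposeE add_lfunE scale_lfunE linearP add_lfunE scale_lfunE.
by rewrite !add_lfunE !scale_lfunE !transposeE.
Qed.

(** By antisymmetry of the bracket, j[x, y] = [jx, y] also reads j[x, y] = [x, jy]: j
    commutes with ad, which transposes to k commuting with the coadjoint action. *)
Lemma mem_Jtspace_comm (k : 'End(dualv g)) :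
  k \in Jtspace g <-> forall x f, k (coad g x f) = coad g x (k f).
Proof.
rewrite mem_Jtspace; split=> [[j /mem_Jspace Jj ->] x f|kC].
  apply/lfunP => y; rewrite transposeE !coadE transposeE; congr (- f _).
  by rewrite (bracketC x y) linearN /= Jj -bracketC.
have [j kE] := transpose_surj k; exists j => //; apply/mem_Jspace.
have jC x y : j ⁅x, y⁆ = ⁅x, j y⁆.
  apply: dual_sep => f; have /lfunP/(_ y) := kC x f.
  by rewrite kE transposeE !coadE transposeE => /oppr_inj.
by move=> x y; rewrite bracketC linearN /= jC -bracketC.
Qed.

Definition block (a : 'End(g)) (x : 'End(dualv g)) (b : 'Hom(g, dualv g))
    (p : 'Hom(dualv g, g)) : 'End(D) :=
  linfun (fun u : D => (a u.1 + p u.2, b u.1 + x u.2) : D).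

Lemma blockE a x b p (u : D) : block a x b p u = (a u.1 + p u.2, b u.1 + x u.2).
Proof.
rewrite /block linfunE // => c v w; congr pair => /=; rewrite !linearP /=.
  by rewrite scalerDr addrACA.
by rewrite scalerDr addrACA.
Qed.

Lemma block_surj (d : 'End(D)) : exists a x b p, d = block a x b p.
Proof.
have lin1 : linear (fun x : g => (x, 0) : D).
  by move=> a x y; congr pair => /=; rewrite scaler0 addr0.
have lin2 : linear (fun f : dualv g => (0, f) : D).
  by move=> a x y; congr pair => /=; rewrite scaler0 addr0.
pose i1 := linfun (fun x : g => (x, 0) : D).
pose i2 := linfun (fun f : dualv g => (0, f) : D).
pose p1 := linfun (fun u : D => u.1).
pose p2 := linfun (fun u : D => u.2).
have p1E u : p1 u = u.1 by rewrite /p1 linfunE.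
have p2E u : p2 u = u.2 by rewrite /p2 linfunE.
exists (p1 \o d \o i1)%VF, (p2 \o d \o i2)%VF, (p2 \o d \o i1)%VF, (p1 \o d \o i2)%VF.
apply/lfunP => u; rewrite blockE !comp_lfunE !p1E !p2E !linfunE //.
rewrite -[RHS]/((_, _) + (_, _) : D) -!surjective_pairing -linearD; congr (d _).
by case: u => x f; congr pair; rewrite /= ?addr0 ?add0r.
Qed.


(** The opposite of the transpose of a derivation a is one solution x of the equation on
    the right; the other ones differ from it by operators commuting with coad. *)
Lemma shifted_Jtspace (a : 'End(g)) (x : 'End(dualv g)) :
    a \in cocycles1 (ad_rep g) ->
  x + transpose a \in Jtspace g <->
  forall y h, x (coad g y h) = coad g y (x h) + coad g (a y) h.
Proof.
move=> /mem_cocycles1 /= aZ.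
have E y h : transpose a (coad g y h) = coad g y (transpose a h) - coad g (a y) h.
  apply/lfunP => w; rewrite transposeE add_lfunE opp_lfunE !coadE transposeE opprK.
  have := aZ y w; rewrite !adE => /eqP; rewrite subr_eq0 => /eqP<-.
  by rewrite linearB /= (bracketC w) linearN /= opprK opprD subrK.
have shift (A B C P : dualv g) : A + (B - C) = P + B <-> A = P + C.
  split=> [H|->]; last by rewrite addrA addrAC addrK.
  by apply: (addIr (B - C)); rewrite H addrA (addrAC P) addrK addrC.
by rewrite mem_Jtspace_comm; split=> H y h; have := H y h;
  rewrite !add_lfunE linearD E; move/shift.
Qed.

(** The cocycle identity is bilinear in u and v, so it can be tested on elements of g and
    of its dual separately; each kind of pair isolates conditions on single blocks. *)
Lemma block_cocycle a x b p :
  block a x b p \in cocycles1 (ad_rep D) <->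
  [/\ a \in cocycles1 (ad_rep g), x + transpose a \in Jtspace g,
      b \in cocycles1 (coad_rep g) & p \in Psispace g].
Proof.
have E0 (V : zmodType) (A B C E : V) : A + B - (C + E) - (A - C + (B - E)) = 0.
  by rewrite opprD addrACA subrr.
have E1 (V : zmodType) (A B C S A' B' C' : V) :
    A + B - (C + S) - (A' + B' - (C' + S)) = (A - A') + ((B + C') - (B' + C)).
  rewrite !opprD !opprK (AC ((2*2)*(2*2)) ((1*5)*((2*7)*(6*3))*(4*8))) /=.
  by rewrite addNr addr0.
have bE (u v : D) : ⁅u, v⁆ = (⁅u.1, v.1⁆, coad g u.1 v.2 - coad g v.1 u.2) by [].
split=> [/mem_cocycles1 /= H|[aZ]]; last first.
  move/(shifted_Jtspace _ aZ) => xJ /mem_cocycles1 /= bZ /mem_Psispace[p1 p2].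
  apply/mem_cocycles1 => /= -[y f] [z h]; rewrite !adE !bE !blockE /=.
  congr pair; rewrite /=.
    rewrite [p (_ - _)]linearB [⁅y, _⁆]linearD [⁅z, _⁆]linearD /=.
    have/mem_cocycles1 := aZ => /(_ y z) /=; rewrite !adE => /eqP.
    rewrite subr_eq0 => /eqP <-.
    have /lfunP/(_ h) := p1 y; rewrite !comp_lfunE adE => ->.
    have /lfunP/(_ f) := p1 z; rewrite !comp_lfunE adE => ->.
    exact: E0.
  rewrite [x (_ - _)]linearB [coad g (_ + _)]linearD [coad g y (_ + _)]linearD.
  rewrite [coad g (_ + _)]linearD [coad g z (_ + _)]linearD /=.
  have /eqP := bZ y z; rewrite subr_eq0 => /eqP <-; rewrite !xJ.
  by rewrite !add_lfunE p2 E1 subrr.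
have H1 y z := congr1 (fun u : D => (u.1, u.2)) (H (y, 0) (z, 0)).
have H2 y h := congr1 (fun u : D => (u.1, u.2)) (H (y, 0) (0, h)).
have H3 f h := congr1 (fun u : D => (u.1, u.2)) (H (0, f) (0, h)).
rewrite /= in H1 H2 H3.
pose simp0 := (linear0, bracket0l, zero_lfunE, oppr0, subr0, addr0, add0r, sub0r, opprK).
have aZ : a \in cocycles1 (ad_rep g).
  apply/mem_cocycles1 => y z /=; case: (H1 y z); rewrite !adE !bE !blockE /=.
  by rewrite !simp0.
split=> //.
- apply/(shifted_Jtspace _ aZ) => y h; case: (H2 y h); rewrite !adE !bE !blockE /=.
  by rewrite !simp0 => _ /eqP; rewrite subr_eq0 => /eqP.
- apply/mem_cocycles1 => y z /=; case: (H1 y z); rewrite !adE !bE !blockE /=.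
  by rewrite !simp0.
apply/mem_Psispace; split=> [y|f h].
  apply/lfunP => h; rewrite !comp_lfunE adE.
  case: (H2 y h); rewrite !adE !bE !blockE /= !simp0.
  by move=> /eqP; rewrite subr_eq0 => /eqP.
case: (H3 f h); rewrite !adE !bE !blockE /= !simp0.
by move=> _ /eqP; rewrite addrC subr_eq0 => /eqP.
Qed.

Lemma block_coboundary a x b p :
  block a x b p \in coboundaries1 (ad_rep D) <->
  [/\ a \in coboundaries1 (ad_rep g), x + transpose a = 0,
      b \in coboundaries1 (coad_rep g) & p = 0].
Proof.
have bE (u v : D) : ⁅u, v⁆ = (⁅u.1, v.1⁆, coad g u.1 v.2 - coad g v.1 u.2) by [].
pose simp0 := (linear0, bracket0l, zero_lfunE, oppr0, subr0, addr0, add0r, sub0r, opprK).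
have xE z : (forall y, a y = ⁅y, z⁆) ->
    (x + transpose a = 0 <-> forall f, x f = - coad g z f).
  move=> aE.
  have tE f : transpose a f = coad g z f.
    by apply/lfunP => w; rewrite transposeE coadE aE (bracketC w) linearN.
  split=> [/eqP|xE]; first by rewrite addr_eq0 => /eqP-> f; rewrite opp_lfunE tE.
  by apply/lfunP => f; rewrite add_lfunE xE tE addNr zero_lfunE.
split=> [/mem_coboundaries1 /= [[z h] H]|].
  have H1 y := congr1 (fun u : D => (u.1, u.2)) (H (y, 0)).
  have H2 f := congr1 (fun u : D => (u.1, u.2)) (H (0, f)).
  rewrite /= in H1 H2.
  have az y : a y = ⁅y, z⁆.
    by case: (H1 y); rewrite !adE !bE !blockE /= !simp0.
  split.
  - by apply/mem_coboundaries1; exists z => y; rewrite adE.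
  - by apply/(xE z az) => f; case: (H2 f); rewrite !adE !bE !blockE /= !simp0.
  - apply/mem_coboundaries1; exists h => y.
    by case: (H1 y); rewrite !adE !bE !blockE /= !simp0.
  by apply/lfunP => f; case: (H2 f); rewrite !adE !bE !blockE /= !simp0.
case=> /mem_coboundaries1 /= [z az] x0 /mem_coboundaries1 /= [h bh] p0.
have az' y : a y = ⁅y, z⁆ by rewrite az adE.
apply/mem_coboundaries1; exists (z, h) => -[y f].
rewrite adE blockE bE /= p0 zero_lfunE addr0 az' bh.
by move/(xE z az'): x0 => ->.
Qed.

Lemma block_linear c a x b p a' x' b' p' :
  block (c *: a + a') (c *: x + x') (c *: b + b') (c *: p + p') =
  c *: block a x b p + block a' x' b' p'.
Proof.
apply/lfunP => u; rewrite !(add_lfunE, scale_lfunE, blockE).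
congr pair; rewrite /= scalerDr; exact: addrACA.
Qed.

Lemma block_eq0 a x b p : block a x b p = 0 -> [/\ a = 0, x = 0, b = 0 & p = 0].
Proof.
move=> /lfunP H.
have H1 y := congr1 (fun u : D => (u.1, u.2)) (H (y, 0)).
have H2 f := congr1 (fun u : D => (u.1, u.2)) (H (0, f)).
by split; apply/lfunP => u; [case: (H1 u)|case: (H2 u)|case: (H1 u)|case: (H2 u)];
  rewrite !blockE /= !zero_lfunE !linear0 ?addr0 ?add0r.
Qed.

Lemma dim_cocycles1_cotangent : \dim (cocycles1 (ad_rep D)) =
  (\dim (cocycles1 (ad_rep g)) + \dim (Jtspace g)
   + \dim (cocycles1 (coad_rep g)) + \dim (Psispace g))%N.
Proof.
pose T : vectType F := (subvs_of (cocycles1 (ad_rep g)) * subvs_of (Jtspace g)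
  * subvs_of (cocycles1 (coad_rep g)) * subvs_of (Psispace g))%type.
pose f (t : T) := block (vsval t.1.1.1) (vsval t.1.1.2 - transpose (vsval t.1.1.1))
  (vsval t.1.2) (vsval t.2).
have f_lin : linear f.
  move=> c s t; rewrite -block_linear /f /= transpose_linear.
  by congr block; rewrite scalerBr opprD addrACA.
have -> : (\dim (cocycles1 (ad_rep g)) + \dim (Jtspace g)
   + \dim (cocycles1 (coad_rep g)) + \dim (Psispace g))%N = dim T by [].
apply: (@dim_inj_img _ _ _ (linfun f)) => [t|w].
  case: t => [[[a k] b] p]; rewrite linfunE // => /block_eq0 /= [a0 k0 b0 p0].
  have t0 : transpose (0 : 'End(g)) = 0.
    by apply/lfunP => h; apply/lfunP => y; rewrite transposeE !zero_lfunE linear0.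
  move: k0; rewrite a0 t0 subr0 => k0.
  by congr (_, _, _, _); apply: val_inj.
have [a [x [b [p ->]]]] := block_surj w; split=> [/block_cocycle[aZ xJ bZ pP]|].
  exists (Subvs aZ, Subvs xJ, Subvs bZ, Subvs pP).
  by rewrite linfunE // /f /= addrK.
case=> -[[[a' k'] b'] p'] <-; rewrite linfunE //; apply/block_cocycle.
by rewrite /= subrK; split; apply: subvsP.
Qed.

Lemma dim_coboundaries1_cotangent : \dim (coboundaries1 (ad_rep D)) =
  (\dim (coboundaries1 (ad_rep g)) + \dim (coboundaries1 (coad_rep g)))%N.
Proof.
pose T : vectType F := (subvs_of (coboundaries1 (ad_rep g))
  * subvs_of (coboundaries1 (coad_rep g)))%type.
pose f (t : T) := block (vsval t.1) (- transpose (vsval t.1)) (vsval t.2) 0.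
have f_lin : linear f.
  move=> c s t; rewrite -block_linear /f /= transpose_linear.
  by congr block; rewrite ?scaler0 ?addr0 // opprD scalerN.
have -> : (\dim (coboundaries1 (ad_rep g)) + \dim (coboundaries1 (coad_rep g)))%N
  = dim T by [].
apply: (@dim_inj_img _ _ _ (linfun f)) => [t|w].
  case: t => [a b]; rewrite linfunE // => /block_eq0 /= [a0 _ b0 _].
  by congr (_, _); apply: val_inj.
have [a [x [b [p ->]]]] := block_surj w; split=> [/block_coboundary[aZ x0 bZ ->]|].
  exists (Subvs aZ, Subvs bZ); rewrite linfunE // /f /=; congr block.
  by apply/eqP; rewrite eq_sym -addr_eq0 x0.
case=> -[a' b'] <-; rewrite linfunE //; apply/block_coboundary.
by rewrite /= addNr; split=> //; apply: subvsP.
Qed.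

Lemma dimH1_cotangent : dim (H1 (ad_rep D)) =
  (dim (H1 (ad_rep g)) + \dim (Jtspace g) + dim (H1 (coad_rep g)) + \dim (Psispace g))%N.
Proof.
apply: (@addnI (\dim (coboundaries1 (ad_rep D)))).
rewrite dimH1 dim_cocycles1_cotangent dim_coboundaries1_cotangent -!dimH1.
by rewrite (AC ((2*1*2)*1) (1*4*((2*3)*5*6))) /= ?addnA.
Qed.

Lemma dim_Jtspace : \dim (Jtspace g) = \dim (Jspace g).
Proof.
pose f (j : subvs_of (Jspace g)) := transpose (vsval j).
have f_lin : linear f by move=> a i j; rewrite /f linearP transpose_linear.
apply: (@dim_inj_img _ _ _ (linfun f)) => [j|k].
  rewrite linfunE // => /lfunP tj; apply/val_inj/lfunP => x.
  apply: dual_sep => h; have /lfunP/(_ x) := tj h.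
  by rewrite transposeE !zero_lfunE linear0.
split=> [/mem_Jtspace[j Jj ->]|[j <-]]; first by exists (Subvs Jj); rewrite linfunE.
by apply/mem_Jtspace; exists (vsval j); rewrite ?subvsP ?linfunE.
Qed.
End Cotangent.

(** * The Killing form *)

Section Killing.
Variables (F : fieldType) (g : lieAlgType F).
Implicit Types (x y z : g).

Lemma ad_bracketE x y :
  ad g ⁅x, y⁆ = ((ad g x \o ad g y) - (ad g y \o ad g x))%VF.
Proof.
by apply/lfunP => v; rewrite ad_bracket add_lfunE opp_lfunE !comp_lfunE.
Qed.

Definition killing : 'Hom(g, dualv g) :=
  linfun (fun x => linfun (fun y => lftrace (ad g x \o ad g y)%VF : F^o)).

Lemma killingE x y : killing x y = lftrace (ad g x \o ad g y)%VF.
Proof.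
have linE u v : linfun (fun y => lftrace (ad g u \o ad g y)%VF : F^o) v =
    lftrace (ad g u \o ad g v)%VF.
  by rewrite linfunE // => a v1 v2; rewrite linearP comp_lfunDr -comp_lfunZr linearP.
rewrite /killing linfunE // => a u v; apply/lfunP => w.
rewrite add_lfunE scale_lfunE !linE linearP comp_lfunDl -comp_lfunZl.
by rewrite [LHS]linearP.
Qed.

Lemma killingC x y : killing x y = killing y x.
Proof. by rewrite !killingE lftrace_comp. Qed.

Lemma killingA x y z : killing ⁅x, y⁆ z = killing x ⁅y, z⁆.
Proof.
rewrite !killingE !ad_bracketE comp_lfunDl comp_lfunDr comp_lfunNl comp_lfunNr.
rewrite !raddfB /= !comp_lfunA; congr (_ - _).
by rewrite [RHS]lftrace_comp comp_lfunA.
Qed.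

Lemma killing_coad x y : killing ⁅x, y⁆ = coad g x (killing y).
Proof.
by apply/lfunP => z; rewrite coadE -killingA (bracketC x) linearN opp_lfunE.
Qed.

(** For a in A, the operator (ad a)(ad y) maps g into A and A to 0: its square is zero. *)
Lemma killing_abelian_ideal (A : {vspace g}) :
    (forall x a, a \in A -> ⁅x, a⁆ \in A) ->
    {in A &, forall a b, ⁅a, b⁆ = 0} ->
  {in A, forall a, killing a = 0}.
Proof.
move=> idA abA a aA; apply/lfunP => y; rewrite zero_lfunE killingE.
have -> : (ad g a \o ad g y = projv A \o (ad g a \o ad g y))%VF.
  apply/lfunP => v; rewrite !comp_lfunE !adE projv_id //.
  by rewrite bracketC memvN idA.
rewrite lftrace_comp; set h := (_ \o projv A)%VF; have -> : h = 0.
  apply/lfunP => v; rewrite !comp_lfunE !adE zero_lfunE abA //.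
  by rewrite idA // memv_proj.
by rewrite [LHS]linear0.
Qed.

End Killing.

(** * Reductive algebras *)

Section Reductive.
Variables (F : fieldType) (g : lieAlgType F).
Implicit Types (x y z : g).

Notation Z := (center g).
Notation S := (lie_prod (@fullv F g) fullv).
Notation Zt := (subvs_of Z).

Lemma derived_ind (P : g -> Prop) :
    P 0 -> (forall a u v, P u -> P v -> P (a *: u + v)) ->
    (forall x y, P ⁅x, y⁆) ->
  {in S, forall x, P x}.
Proof.
move=> P0 Plin Pbr x xS; apply/(mem_vspace_of P0 Plin).
apply: (subvP (lie_prod_sub _)) xS => u v _ _.
exact/(mem_vspace_of P0 Plin).
Qed.

Lemma lfun_derived0 (V : vectType F) (f : 'Hom(g, V)) :
  (forall x y, f ⁅x, y⁆ = 0) -> {in S, forall x, f x = 0}.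
Proof.
move=> f0; apply: derived_ind => [|a u v fu fv|//]; first exact: linear0.
by rewrite linearP /= fu fv scaler0 addr0.
Qed.

Lemma mem_derived x y : ⁅x, y⁆ \in S.
Proof. by rewrite mem_lie_prod ?memvf. Qed.

Lemma center_l z y : z \in Z -> ⁅z, y⁆ = 0.
Proof. by move/mem_center. Qed.
Lemma center_r z y : z \in Z -> ⁅y, z⁆ = 0.
Proof. by move=> zZ; rewrite bracketC center_l ?oppr0. Qed.

Lemma killing_center z : z \in Z -> killing g z = 0.
Proof.
apply: (@killing_abelian_ideal _ _ Z) => [x a aZ|a b aZ _]; last exact: center_l.
by rewrite center_r // mem0v.
Qed.

(** What semisimple and compact algebras have in common. *)
Definition killing_reductive : Prop :=
  [/\ forall x, killing g x = 0 -> x \in Z, (Z + S = fullv)%VS & (Z :&: S = 0)%VS].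

Hypothesis red : killing_reductive.

Definition zinc : 'Hom(Zt, g) := linfun vsval.
Definition zproj : 'Hom(g, Zt) := linfun (vsproj Z \o daddv_pi Z S).

Lemma zprojE x : zproj x = vsproj Z (daddv_pi Z S x).
Proof. by rewrite /zproj lfunE. Qed.

Lemma zincE (z : Zt) : zinc z = vsval z.
Proof. by rewrite /zinc lfunE. Qed.

Lemma zproj_derived : {in S, forall x, zproj x = 0}.
Proof.
have [_ _ cap0] := red; move=> x xS; rewrite zprojE.
suff -> : daddv_pi Z S x = 0 by rewrite linear0.
have xE : daddv_pi Z S x + daddv_pi S Z x = x.
  by rewrite daddv_pi_add // (subvP (addvSr _ _)).
move: xE; rewrite [daddv_pi S Z x]daddv_pi_id //; last by rewrite capvC.
by rewrite -[in RHS](add0r x) => /addIr.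
Qed.

Lemma zproj_bracket x y : zproj ⁅x, y⁆ = 0.
Proof. by rewrite zproj_derived ?mem_derived. Qed.

Lemma zincK z : z \in Z -> zinc (zproj z) = z.
Proof.
have [_ _ cap0] := red; move=> zZ.
by rewrite zincE zprojE daddv_pi_id // vsprojK.
Qed.

Lemma zprojK (z : Zt) : zproj (zinc z) = z.
Proof. by apply: subvs_inj; rewrite -!zincE zincK // zincE; apply: subvsP. Qed.

Lemma zinc_center (z : Zt) : zinc z \in Z.
Proof. by rewrite zincE subvsP. Qed.

Lemma sub_zproj_derived x : x - zinc (zproj x) \in S.
Proof.
have [_ sumf cap0] := red.
have : x \in (Z + S)%VS by rewrite sumf memvf.
case/memv_addP=> z zZ [s sS ->].
by rewrite linearD /= (zproj_derived sS) addr0 zincK // addrC addKr.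
Qed.

Lemma lfun_reductive0 (V : vectType F) (f : 'Hom(g, V)) :
  (forall x y, f ⁅x, y⁆ = 0) -> {in Z, forall z, f z = 0} -> f = 0.
Proof.
move=> fbr fZ; apply/lfunP => x; rewrite zero_lfunE.
rewrite -(subrK (zinc (zproj x)) x) linearD /= [f (zinc _)]fZ ?zinc_center // addr0.
by rewrite lfun_derived0 // sub_zproj_derived.
Qed.

Lemma derived_center0 x : x \in S -> x \in Z -> x = 0.
Proof.
have [_ _ cap0] := red => xS xZ.
by apply/eqP; rewrite -memv0 -cap0 memv_cap xS xZ.
Qed.

(** The image of the Killing form lies in the annihilator of Z, and both have
    dimension dim g - dim Z. *)
Lemma killing_surj (f : dualv g) :
  {in Z, forall z, f z = 0} -> f \in limg (killing g).
Proof.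
have [ker _ _] := red.
pose r := linfun (fun h : dualv g => (h \o zinc)%VF : dualv Zt).
have rE h (z : Zt) : r h z = h (zinc z).
  rewrite /r linfunE ?comp_lfunE // => a u v.
  by rewrite comp_lfunDl comp_lfunZl.
have imgr : limg r = fullv.
  apply/eqP; rewrite eqEsubv subvf; apply/subvP => h _; apply/memv_imgP.
  exists (h \o zproj)%VF; rewrite ?memvf //; apply/lfunP => z.
  by rewrite rE comp_lfunE zprojK.
have sub : (limg (killing g) <= lker r)%VS.
  apply/subvP => _ /memv_imgP[x _ ->]; rewrite memv_ker; apply/eqP/lfunP => z.
  by rewrite rE killingC killing_center ?zinc_center // !zero_lfunE.
have kerk : lker (killing g) = Z.
  apply/vspaceP => x; rewrite memv_ker; apply/eqP/idP; first exact: ker.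
  exact: killing_center.
have eqk : limg (killing g) = lker r.
  apply/eqP; rewrite eqEdim sub /=.
  have := limg_ker_dim (killing g) fullv; have := limg_ker_dim r fullv.
  rewrite !capfv kerk imgr !dimvf !dim_dual => <- /eqP.
  by rewrite addnC eqn_add2r => /eqP->.
move=> fZ; rewrite eqk memv_ker; apply/eqP/lfunP => z.
by rewrite rE fZ ?zinc_center // zero_lfunE.
Qed.

End Reductive.

Section ReductiveCohomology.
Variables (F : fieldType) (g : lieAlgType F).
Implicit Types (x y : g).

Notation Z := (center g).
Notation S := (lie_prod (@fullv F g) fullv).
Notation Zt := (subvs_of Z).
Notation zinc := (@zinc F g).
Notation zproj := (@zproj F g).

Hypothesis red : killing_reductive g.

Lemma bracketNl x y : ⁅- x, y⁆ = - ⁅x, y⁆.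
Proof. by rewrite bracketC linearN /= opprK bracketC. Qed.

Lemma derivationP (d : 'End(g)) :
  d \in cocycles1 (ad_rep g) <-> forall x y, d ⁅x, y⁆ = ⁅d x, y⁆ + ⁅x, d y⁆.
Proof.
rewrite mem_cocycles1 /=.
have E x y : ad g x (d y) - ad g y (d x) - d ⁅x, y⁆ = ⁅d x, y⁆ + ⁅x, d y⁆ - d ⁅x, y⁆.
  by rewrite !adE (bracketC y) opprK addrC [in RHS]addrC [⁅x, _⁆ + _]addrC.
split=> H x y; last by rewrite E H subrr.
by have /eqP := H x y; rewrite E subr_eq0 => /eqP.
Qed.

(** The functional x |-> tr (d o ad x) vanishes on Z, hence is the Killing form against
    some w. For e = d - ad w, the Killing form of e x and y is tr (e o ad [x, y]) = 0, so
    e takes its values in Z and therefore vanishes on brackets. *)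
Lemma derivation_inner (d : 'End(g)) :
    (forall x y, d ⁅x, y⁆ = ⁅d x, y⁆ + ⁅x, d y⁆) -> {in Z, forall z, d z = 0} ->
  exists w, forall x, d x = ⁅x, w⁆.
Proof.
have [ker _ _] := red.
move=> dD dZ; pose t := linfun (fun x => lftrace (d \o ad g x)%VF : F^o).
have tE x : t x = lftrace (d \o ad g x)%VF.
  rewrite /t linfunE // => a u v.
  by rewrite linearP comp_lfunDr -comp_lfunZr [LHS]linearP.
have /memv_imgP[w _ tw] : t \in limg (killing g).
  apply: killing_surj => // z zZ; rewrite tE; have -> : ad g z = 0.
    by apply/lfunP => y; rewrite adE zero_lfunE center_l.
  by rewrite comp_lfun0r [LHS]linear0.
pose e := d - ad g w.
have eE x : e x = d x - ⁅w, x⁆ by rewrite add_lfunE opp_lfunE adE.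
have eD x y : e ⁅x, y⁆ = ⁅e x, y⁆ + ⁅x, e y⁆.
  rewrite !eE dD bracketDl bracketNl bracketA [⁅x, d y - _⁆]linearB /=.
  by rewrite opprB addrACA [_ - _ - _]addrAC subrr add0r.
have te x : lftrace (e \o ad g x)%VF = 0.
  rewrite /e comp_lfunDl comp_lfunNl [LHS]linearB /= -tE tw -killingE.
  exact: subrr.
clearbody e.
have eZ x : e x \in Z.
  apply: ker; apply/lfunP => y; rewrite zero_lfunE killingE.
  have -> : ad g (e x) = ((e \o ad g x) - (ad g x \o e))%VF.
    apply/lfunP => v; rewrite add_lfunE opp_lfunE !comp_lfunE !adE eD addrK.
    by [].
  rewrite -(te ⁅x, y⁆) ad_bracketE comp_lfunDl comp_lfunDr comp_lfunNl comp_lfunNr.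
  rewrite [LHS]linearB [RHS]linearB /= !comp_lfunA; congr (_ - _).
  by rewrite [RHS]lftrace_comp comp_lfunA.
exists (- w) => x; rewrite linearN /= -bracketC.
suff e0 : e = 0 by have /eqP := eE x; rewrite e0 zero_lfunE eq_sym subr_eq0 => /eqP.
apply: lfun_reductive0 => // [u v|z zZ].
  by rewrite eD center_l ?center_r ?addr0.
by rewrite eE dZ // center_r ?subr0.
Qed.

(** Derivations preserve Z, and those vanishing on Z are the inner ones: the class of a
    derivation is its restriction to Z. *)
Lemma dimH1_ad : dim (H1 (ad_rep g)) = (\dim Z * \dim Z)%N.
Proof.
pose f := linfun (fun d : 'End(g) => (zproj \o d \o zinc)%VF : 'End(Zt)).
have fE d : f d = (zproj \o d \o zinc)%VF.
  rewrite /f linfunE // => a u v.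
  by rewrite comp_lfunDr comp_lfunDl -comp_lfunZr -comp_lfunZl.
apply: (@dimH1_eq _ _ _ _ _ f) => [d /derivationP dD|w].
  split=> [d0|/mem_coboundaries1 /= [w dw]].
    have [|w dw] := @derivation_inner d dD.
      move=> z zZ; have dzZ : d z \in Z.
        apply/mem_center => y; apply: (@addIr _ ⁅z, d y⁆).
        by rewrite -dD center_l // linear0 add0r center_l.
      rewrite -(zincK red dzZ) -(zincK red zZ).
      have := congr1 (fun h : 'End(Zt) => h (zproj z)) d0.
      by rewrite fE !comp_lfunE zero_lfunE => ->; rewrite linear0.
    by apply/mem_coboundaries1; exists w => x; rewrite adE.
  rewrite fE; apply/lfunP => z; rewrite !comp_lfunE dw adE zproj_bracket //.
  by rewrite zero_lfunE.
exists (zinc \o w \o zproj)%VF.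
  apply/derivationP => x y; rewrite !comp_lfunE zproj_bracket // !linear0.
  by rewrite center_l ?center_r ?addr0 ?zinc_center.
by rewrite fE; apply/lfunP => z; rewrite !comp_lfunE !zprojK.
Qed.

(** The class of b is the form it induces on Z. If that form is zero, b x vanishes on Z
    for every x, so b x is the Killing form against some d x in S, and d is a derivation
    vanishing on Z. *)
Lemma dimH1_coad : dim (H1 (coad_rep g)) = (\dim Z * \dim Z)%N.
Proof.
have [ker _ _] := red.
pose f := linfun (fun b : 'Hom(g, dualv g) =>
   linfun (fun z : Zt => (b (zinc z) \o zinc)%VF : dualv Zt)).
have gE (b : 'Hom(g, dualv g)) (z : Zt) :
   linfun (fun z : Zt => (b (zinc z) \o zinc)%VF : dualv Zt) z = (b (zinc z) \o zinc)%VF.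
  rewrite linfunE // => a u v.
  by rewrite !linearP comp_lfunDl -comp_lfunZl.
have fE b (z z' : Zt) : f b z z' = b (zinc z) (zinc z').
  rewrite /f linfunE; first by rewrite gE comp_lfunE.
  move=> a u v; apply/lfunP => w; rewrite add_lfunE scale_lfunE !gE.
  by rewrite add_lfunE scale_lfunE comp_lfunDl comp_lfunZl.
have -> : (\dim Z * \dim Z)%N = dim 'Hom(Zt, dualv Zt).
  by rewrite -[RHS]/(dim Zt * dim (dualv Zt))%N dim_dual.
apply: (@dimH1_eq _ _ _ _ _ f) => [b /mem_cocycles1 /= bC|w].
  have bE x y v : b ⁅x, y⁆ v = b x ⁅y, v⁆ - b y ⁅x, v⁆.
    have /eqP := bC x y; rewrite subr_eq0 => /eqP<-.
    by rewrite add_lfunE opp_lfunE !coadE opprK addrC.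
  split=> [b0|/mem_coboundaries1 /= [h bh]]; last first.
    apply/lfunP => z; apply/lfunP => z'; rewrite fE bh coadE !zero_lfunE.
    by rewrite center_l ?zinc_center ?linear0 ?oppr0.
  have bZ z : z \in Z -> b z = 0.
    move=> zZ; apply: lfun_reductive0 => // [x y|z' z'Z].
      have := bE x z y; rewrite center_r // linear0 zero_lfunE.
      by rewrite center_l // linear0 sub0r => /esym/eqP; rewrite oppr_eq0 => /eqP.
    rewrite -(zincK red zZ) -(zincK red z'Z) -fE b0 !zero_lfunE.
    by [].
  have bx0 x z : z \in Z -> b x z = 0.
    move=> zZ; pose ev := linfun (fun x => b x z : F^o).
    have evE u : ev u = b u z.
      by rewrite /ev linfunE // => a u1 u2; rewrite linearP add_lfunE scale_lfunE.
    rewrite -evE; suff -> : ev = 0 by rewrite zero_lfunE.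
    apply: lfun_reductive0 => // [u v|z' z'Z]; rewrite evE.
      by rewrite bE !(center_r _ zZ) !linear0 addr0.
    by rewrite bZ // zero_lfunE.
  pose d := (((\1 - (zinc \o zproj)) \o (killing g)^-1) \o b)%VF.
  have dE x : killing g (d x) = b x.
    rewrite !comp_lfunE add_lfunE opp_lfunE id_lfunE comp_lfunE linearB /=.
    rewrite [killing g (zinc _)]killing_center ?zinc_center // subr0.
    by rewrite limg_lfunVK // killing_surj // => z; apply: bx0.
  have dS x : d x \in S.
    by rewrite !comp_lfunE add_lfunE opp_lfunE id_lfunE comp_lfunE sub_zproj_derived.
  have [|z zZ|w dw] := @derivation_inner d.
  - move=> x y; apply/eqP; rewrite -subr_eq0; apply/eqP.
    apply: (derived_center0 red); first by rewrite memvB ?memvD ?mem_derived.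
    apply: ker; apply/lfunP => v; rewrite linearB linearD (bracketC x (d y)) linearN /=.
    by rewrite !(add_lfunE, opp_lfunE) !killingA !dE bE subrr zero_lfunE.
  - by rewrite !comp_lfunE bZ // !linear0.
  apply/mem_coboundaries1; exists (killing g w) => x.
  by rewrite /= -killing_coad -dw dE.
pose c : 'Hom(g, dualv g) := linfun (fun x => (w (zproj x) \o zproj)%VF).
have cE x v : c x v = w (zproj x) (zproj v).
  rewrite /c linfunE ?comp_lfunE // => a u1 u2.
  by rewrite !linearP comp_lfunDl -comp_lfunZl.
exists c; last by apply/lfunP => z; apply/lfunP => z'; rewrite fE cE !zprojK.
apply/mem_cocycles1 => x y /=; apply/lfunP => v.
rewrite !(add_lfunE, opp_lfunE) !coadE !cE !zproj_bracket //.
by rewrite !linear0 !zero_lfunE !linear0 !addr0.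
Qed.

(** The bracket [p h, p h'] = p (ad*_(p h) h') is symmetric in h and h', hence zero: the
    image of p is an abelian ideal, so it lies in Z. Then p kills the Killing form
    against any bracket, so it factors through the restriction of functionals to Z. *)
Lemma dim_Psispace : 2%:R != 0 :> F -> \dim (Psispace g) = (\dim Z * \dim Z)%N.
Proof.
have [ker _ _] := red; move=> char2.
pose pz : 'Hom(dualv Zt, dualv g) := linfun (fun h : dualv Zt => (h \o zproj)%VF).
have pzE h x : pz h x = h (zproj x).
  by rewrite /pz linfunE ?comp_lfunE // => a u v; rewrite comp_lfunDl comp_lfunZl.
pose rz : 'Hom(dualv g, dualv Zt) := linfun (fun h : dualv g => (h \o zinc)%VF).
have rzE h (z : Zt) : rz h z = h (zinc z).
  by rewrite /rz linfunE ?comp_lfunE // => a u v; rewrite comp_lfunDl comp_lfunZl.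
pose f := linfun (fun p : 'Hom(dualv g, g) => (zproj \o p \o pz)%VF).
have fE p : f p = (zproj \o p \o pz)%VF.
  rewrite /f linfunE // => a u v.
  by rewrite comp_lfunDr comp_lfunDl -comp_lfunZr -comp_lfunZl.
have -> : (\dim Z * \dim Z)%N = dim 'Hom(dualv Zt, Zt).
  by rewrite -[RHS]/(dim (dualv Zt) * dim Zt)%N dim_dual.
apply: (@dim_bij _ _ _ f) => [p /mem_Psispace[p1 p2] p0|w].
  have pC x h : p (coad g x h) = ⁅x, p h⁆.
    by have /lfunP/(_ h) := p1 x; rewrite !comp_lfunE adE.
  have pp h h' : ⁅p h, p h'⁆ = 0.
    have E : ⁅p h, p h'⁆ = ⁅p h', p h⁆ by rewrite -!pC p2.
    have /eqP : 2%:R *: ⁅p h, p h'⁆ = 0.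
      by rewrite scaler_nat mulr2n {2}E (bracketC (p h')) subrr.
    by rewrite scaler_eq0 (negPf char2) => /eqP.
  have pZ h : p h \in Z.
    apply/ker/(@killing_abelian_ideal _ _ (limg p)); last by rewrite memv_img ?memvf.
      by move=> x _ /memv_imgP[h' _ ->]; rewrite -pC memv_img ?memvf.
    by move=> _ _ /memv_imgP[h1 _ ->] /memv_imgP[h2 _ ->].
  have pk x : p (killing g x) = 0.
    rewrite -comp_lfunE (_ : (p \o killing g)%VF = 0) ?zero_lfunE //.
    apply: lfun_reductive0 => // [u v|z zZ]; rewrite comp_lfunE.
      by rewrite killing_coad pC center_r.
    by rewrite killing_center ?linear0.
  apply/lfunP => h; rewrite zero_lfunE -(subrK (pz (rz h)) h) linearD /=.
  have /memv_imgP[x _ ->] : h - pz (rz h) \in limg (killing g).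
    apply: killing_surj => // z zZ; rewrite add_lfunE opp_lfunE pzE rzE zincK //.
    exact: subrr.
  rewrite pk add0r -(zincK red (pZ _)).
  have := congr1 (fun q : 'Hom(dualv Zt, Zt) => q (rz h)) p0.
  by rewrite fE !comp_lfunE zero_lfunE => ->; rewrite linear0.
exists (zinc \o w \o rz)%VF.
  apply/mem_Psispace; split=> [x|h h'].
    apply/lfunP => h; rewrite !comp_lfunE adE center_r ?zinc_center //.
    suff -> : rz (coad g x h) = 0 by rewrite !linear0.
    apply/lfunP => z; rewrite rzE coadE center_r ?zinc_center //.
    by rewrite linear0 oppr0 zero_lfunE.
  apply/lfunP => x; rewrite !coadE !comp_lfunE !center_l ?zinc_center //.
  by rewrite !linear0.
rewrite fE; apply/lfunP => h; rewrite !comp_lfunE zprojK //; congr (w _).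
by apply/lfunP => z; rewrite rzE pzE zprojK.
Qed.

End ReductiveCohomology.

(** * The centroid *)

Section RealEigen.
Variable R : rcfType.
Local Notation C := (complex R).

Lemma Re_sum I (r : seq I) (P : pred I) (f : I -> C) :
  complex.Re (\sum_(i <- r | P i) f i) = \sum_(i <- r | P i) complex.Re (f i).
Proof. by apply: (big_morph (@complex.Re R)) => // -[a b] [c d]. Qed.

Lemma Im_sum I (r : seq I) (P : pred I) (f : I -> C) :
  complex.Im (\sum_(i <- r | P i) f i) = \sum_(i <- r | P i) complex.Im (f i).
Proof. by apply: (big_morph (@complex.Im R)) => // -[a b] [c d]. Qed.

(** The vectors u and v are the real and imaginary parts of an eigenvector of the
    complexified operator, for the eigenvalue a + i b. *)
Lemma real_eigenpair (V : vectType R) (U : {vspace V}) (j : 'End(V)) :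
    U != 0%VS -> {in U, forall x, j x \in U} ->
  exists a b u v, [/\ u \in U, v \in U, (u != 0) || (v != 0),
    j u = a *: u - b *: v & j v = b *: u + a *: v].
Proof.
move=> U0 jU; pose e := vbasis U; pose m := \dim U.
pose M : 'M[R]_m := \matrix_(i, k) coord e k (j e`_i).
have m0 : (0 < m)%N by rewrite lt0n dimv_eq0.
have [[al be]] := eigenvalue_closed (map_mx (real_complex R) M) m0.
case/eigenvalueP => w wM w0.
pose u := \sum_(i < m) complex.Re (w 0 i) *: e`_i.
pose v := \sum_(i < m) complex.Im (w 0 i) *: e`_i.
have eU i : (i < m)%N -> e`_i \in U.
  by move=> im; rewrite vbasis_mem // mem_nth // size_tuple.
have je (i : 'I_m) : j e`_i = \sum_(k < m) M i k *: e`_k.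
  rewrite (coord_vbasis (jU _ (eU i (ltn_ord i)))).
  by apply: eq_bigr => k _; rewrite mxE.
have jlin (c : 'I_m -> R) : j (\sum_(i < m) c i *: e`_i) =
    \sum_(k < m) (\sum_(i < m) c i * M i k) *: e`_k.
  rewrite linear_sum (eq_bigr (fun i => \sum_(k < m) (c i * M i k) *: e`_k)).
    by rewrite exchange_big; apply: eq_bigr => k _; rewrite scaler_suml.
  by move=> i _; rewrite linearZ /= je scaler_sumr; apply: eq_bigr => k _; rewrite scalerA.
have wMk k := congr1 (fun A : 'rV[C]_m => A 0 k) wM.
exists al, be, u, v; split.
- by rewrite rpred_sum // => i _; rewrite rpredZ ?eU.
- by rewrite rpred_sum // => i _; rewrite rpredZ ?eU.
- rewrite -negb_and; apply: contraNN w0 => /andP[/eqP u0 /eqP v0].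
  have /freeP fe := basis_free (vbasisP U).
  apply/eqP/rowP => i; rewrite mxE; apply/eqP; rewrite eq_complex.
  by rewrite (fe _ u0) (fe _ v0) eqxx.
- rewrite jlin /u /v !scaler_sumr -sumrB; apply: eq_bigr => k _.
  rewrite !scalerA -scalerBl; congr (_ *: _).
  have := congr1 (@complex.Re R) (wMk k); rewrite !mxE Re_sum /=.
  case: (w 0 k) => a b /= <-; apply: eq_bigr => i _; rewrite !mxE /=.
  by case: (w 0 i) => c d /=; rewrite mulr0 subr0.
rewrite jlin /u /v !scaler_sumr -big_split; apply: eq_bigr => k _ /=.
rewrite !scalerA -scalerDl; congr (_ *: _).
have := congr1 (@complex.Im R) (wMk k); rewrite !mxE Im_sum /=.
case: (w 0 k) => a b /=; rewrite addrC => <-; apply: eq_bigr => i _; rewrite !mxE /=.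
by case: (w 0 i) => c d /=; rewrite mulr0 add0r.
Qed.

End RealEigen.

Section Centroid.
Variables (R : rcfType) (g : lieAlgType R).
Implicit Types (s : {vspace g}) (x y : g).

Lemma centroid_r (j : 'End(g)) : j \in Jspace g -> forall x y, j ⁅x, y⁆ = ⁅x, j y⁆.
Proof.
by move=> /mem_Jspace Jj x y; rewrite bracketC linearN /= Jj -bracketC.
Qed.

Lemma simple_perfect s : simple_lie s -> lie_ideal fullv s -> lie_prod s s = s.
Proof.
move=> [[x xs [y ys xy0]] simp] [_ ids].
have [|p0|//] := simp (lie_prod s s).
  split; first by apply: lie_prod_sub => u v us vs; rewrite ids ?memvf.
  move=> u v us /(subvP _) vs; rewrite mem_lie_prod //.
  by apply: vs; apply: lie_prod_sub => a b aS bS; rewrite ids ?memvf.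
by have := mem_lie_prod xs ys; rewrite p0 memv0 (negPf xy0).
Qed.

(** Here s = [s, s], and j[u, v] = [j u, v]. *)
Lemma centroid_stable s j : simple_lie s -> lie_ideal fullv s ->
  j \in Jspace g -> {in s, forall x, j x \in s}.
Proof.
move=> simp ids Jj x; rewrite -{1}(simple_perfect simp ids).
suff : (lie_prod s s <= j @^-1: s)%VS by move=> /subvP/[apply]; rewrite -memv_preim.
apply: lie_prod_sub => u v us vs; rewrite -memv_preim.
by move/mem_Jspace: Jj => ->; case: ids => _ ids; rewrite ids ?memvf.
Qed.

(** The kernel of an operator commuting with ad meets s in an ideal. *)
Lemma simple_kernel s (t : 'End(g)) : simple_lie s -> lie_ideal fullv s ->
    (forall x y, t ⁅x, y⁆ = ⁅x, t y⁆) ->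
    (exists2 x, x \in s & x != 0 /\ t x = 0) -> {in s, forall x, t x = 0}.
Proof.
move=> [_ simp] [_ ids] tC [x xs [x0 tx0]] y ys.
have [|k0|ks] := simp (s :&: lker t)%VS.
- split; first exact: capvSl.
  move=> u v us; rewrite !memv_cap !memv_ker => /andP[vs /eqP tv].
  by rewrite ids ?memvf // tC tv linear0 eqxx.
- have : x \in (s :&: lker t)%VS by rewrite memv_cap xs memv_ker tx0 eqxx.
  by rewrite k0 memv0 (negPf x0).
by move: ys; rewrite -ks memv_cap memv_ker => /andP[_ /eqP].
Qed.

(** For an eigenvalue al + i be of j on s, the operator d = j - al satisfies
    d^2 + be^2 = 0 on a nonzero vector of s, hence on s. If be is nonzero, d / be is a
    complex structure; otherwise d itself kills a nonzero vector of s. *)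
Lemma centroid_scalar s j : simple_lie s -> lie_ideal fullv s ->
    ~ has_complex_structure s -> j \in Jspace g ->
  exists a, {in s, forall x, j x = a *: x}.
Proof.
move=> simp ids nocx Jj.
have s0 : s != 0%VS.
  case: simp => [[x xs [y _ xy0]] _]; apply: contraNneq xy0 => s0.
  by move: xs; rewrite s0 memv0 => /eqP->; rewrite bracket0l.
have [al [be [u [v [us vs uv0 ju jv]]]]] :=
  real_eigenpair s0 (centroid_stable simp ids Jj).
have jC := centroid_r Jj.
have jC' := (mem_Jspace j).1 Jj.
pose d := j - al *: \1%VF.
have dE x : d x = j x - al *: x.
  by rewrite add_lfunE opp_lfunE scale_lfunE id_lfunE.
clearbody d.
have dC x y : d ⁅x, y⁆ = ⁅x, d y⁆.
  by rewrite !dE jC [⁅x, _ - _⁆]linearB /= [⁅x, al *: _⁆]linearZ.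
have dC' x y : d ⁅x, y⁆ = ⁅d x, y⁆.
  by rewrite (bracketC x y) linearN /= dC -bracketC.
have du : d u = - (be *: v) by rewrite dE ju addrAC subrr add0r.
have dv : d v = be *: u by rewrite dE jv addrK.
have ds x : x \in s -> d x \in s.
  by move=> xs; rewrite dE memvB ?memvZ // (centroid_stable simp ids Jj).
have [be0|be0] := eqVneq be 0.
  exists al => x xs; apply/eqP; rewrite -subr_eq0 -dE; apply/eqP.
  apply: (simple_kernel simp ids dC) xs.
  case/orP: uv0 => ?; [exists u => //|exists v => //].
    by rewrite du be0 scale0r oppr0.
  by rewrite dv be0 scale0r.
case: nocx; pose t := (d \o d + (be ^+ 2) *: \1)%VF.
have tE x : t x = d (d x) + be ^+ 2 *: x.
  by rewrite add_lfunE scale_lfunE id_lfunE comp_lfunE.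
clearbody t.
have t0 : {in s, forall x, t x = 0}.
  apply: (simple_kernel simp ids) => [x y|].
    by rewrite !tE !dC [⁅x, _ + _⁆]linearD /= [⁅x, _ *: _⁆]linearZ.
  case/orP: uv0 => ?; [exists u => //|exists v => //]; split => //; rewrite tE.
    by rewrite du linearN linearZ /= dv scalerA expr2 addNr.
  by rewrite dv linearZ /= du scalerN scalerA expr2 addNr.
exists (be^-1 *: d); split=> [x xs|x y xs ys].
  split; first by rewrite scale_lfunE memvZ ?ds.
  have /eqP := t0 x xs; rewrite tE addr_eq0 => /eqP dd.
  rewrite !scale_lfunE linearZ /= dd !scalerN !scalerA -invfM -expr2 mulVf ?scale1r //.
  by rewrite expf_neq0.
by rewrite !scale_lfunE dC' bracketZl.
Qed.

End Centroid.

(** * Decomposition into simple ideals *)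

Section ReductiveIdeals.
Variables (F : fieldType) (g : lieAlgType F).
Implicit Types (x y : g) (I U : {vspace g}).

Notation Z := (center g).
Notation S := (lie_prod (@fullv F g) fullv).
Notation Zt := (subvs_of Z).
Notation zinc := (@zinc F g).
Notation zproj := (@zproj F g).

Hypothesis red : killing_reductive g.

Lemma derived_ideal I : lie_ideal S I -> lie_ideal fullv I.
Proof.
move=> [sIS idI]; split=> [|x a _ aI]; first exact: subvf.
rewrite -(subrK (zinc (zproj x)) x) bracketDl [⁅zinc _, _⁆]center_l ?zinc_center //.
by rewrite addr0 idI // sub_zproj_derived.
Qed.

Lemma ideal_r I : lie_ideal fullv I -> forall x a, a \in I -> ⁅x, a⁆ \in I.
Proof. by move=> [_ idI] x a aI; rewrite idI ?memvf. Qed.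

Lemma ideal_l I : lie_ideal fullv I -> forall x a, a \in I -> ⁅a, x⁆ \in I.
Proof. by move=> idI x a aI; rewrite bracketC memvN (ideal_r idI). Qed.

Lemma killing_derived0 x : x \in S -> killing g x = 0 -> x = 0.
Proof. by have [ker _ _] := red; move=> xS /ker; apply: derived_center0. Qed.

Lemma abelian_ideal0 I : lie_ideal fullv I -> (I <= S)%VS ->
  {in I &, forall a b, ⁅a, b⁆ = 0} -> I = 0%VS.
Proof.
move=> idI sIS abI; apply/eqP; rewrite -subv0; apply/subvP => a aI.
rewrite memv0; apply/eqP/killing_derived0; first exact: (subvP sIS).
exact: (killing_abelian_ideal (ideal_r idI) abI).
Qed.

Definition killing_orth I : {vspace g} :=
  vspace_of (fun x => {in I, forall a, killing g x a = 0}).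

Lemma mem_killing_orth I x :
  x \in killing_orth I <-> {in I, forall a, killing g x a = 0}.
Proof.
apply: (@mem_vspace_of _ _ (fun x => {in I, forall a, killing g x a = 0})).
  by move=> a _; rewrite linear0 zero_lfunE.
move=> c u v uI vI a aI.
by rewrite linearP add_lfunE scale_lfunE uI // vI // scaler0 addr0.
Qed.

Lemma killing_orth_ideal I : lie_ideal fullv I -> lie_ideal fullv (killing_orth I).
Proof.
move=> idI; split=> [|x a _ /mem_killing_orth aI]; first exact: subvf.
apply/mem_killing_orth => b bI.
by rewrite bracketC linearN opp_lfunE killingA aI ?oppr0 // (ideal_r idI).
Qed.

(** For a, b in the intersection, the Killing form of [a, b] and z is that of a and
    [b, z], which lies in I: the intersection is an abelian ideal. *)
Lemma killing_orth_cap I : lie_ideal fullv I -> (I <= S)%VS ->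
  (I :&: killing_orth I = 0)%VS.
Proof.
have [ker _ _] := red; move=> idI sIS.
apply: abelian_ideal0; last 1 first.
- move=> a b; rewrite !memv_cap => /andP[aI /mem_killing_orth aO] /andP[bI _].
  apply: derived_center0 => //; first exact: mem_derived.
  apply: ker; apply/lfunP => z; rewrite killingA aO ?zero_lfunE //.
  exact: ideal_l.
- split=> [|x a _]; first exact: subvf.
  rewrite !memv_cap => /andP[aI aO]; rewrite (ideal_r idI) //=.
  exact: (ideal_r (killing_orth_ideal idI)).
exact: subv_trans (capvSl _ _) sIS.
Qed.

(** Nondegeneracy on I lets every functional on I, in particular the restriction of
    the Killing form against u, be represented by an element of I. *)
Lemma killing_orth_split I u : lie_ideal fullv I -> (I <= S)%VS ->
  exists2 a, a \in I & u - a \in killing_orth I.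
Proof.
move=> idI sIS.
pose r := linfun (fun x => (killing g x \o linfun (vsval : subvs_of I -> g))%VF
                      : dualv (subvs_of I)).
have rE x (a : subvs_of I) : r x a = killing g x (vsval a).
  rewrite /r linfunE ?comp_lfunE ?lfunE // => c v w.
  by rewrite linearP comp_lfunDl comp_lfunZl.
have ri : (I :&: lker r = 0)%VS.
  apply/eqP; rewrite -subv0 -(killing_orth_cap idI sIS); apply/subvP => x.
  rewrite !memv_cap memv_ker => /andP[-> /eqP/lfunP rx]; apply/mem_killing_orth => a aI.
  by have := rx (Subvs aI); rewrite rE zero_lfunE.
have rI : (r @: I)%VS = fullv.
  by apply/eqP; rewrite eqEdim subvf dimvf dim_dual limg_dim_eq //=.
have /memv_imgP[a aI ra] : r u \in (r @: I)%VS by rewrite rI memvf.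
exists a => //; apply/mem_killing_orth => b bI.
rewrite linearB add_lfunE opp_lfunE.
by have /lfunP/(_ (Subvs bI)) := ra; rewrite !rE /= => ->; rewrite subrr.
Qed.

Lemma minimal_ideal U : lie_ideal fullv U -> U != 0%VS ->
  exists I, [/\ lie_ideal fullv I, (I <= U)%VS, I != 0%VS &
    forall K, lie_ideal fullv K -> (K <= I)%VS -> K = 0%VS \/ K = I].
Proof.
move=> idU U0.
pose D := [pred n | `[< exists I,
  [/\ lie_ideal fullv I, (I <= U)%VS, I != 0%VS & \dim I = n] >]].
have exD : exists n, D n by exists (\dim U); apply/asboolP; exists U.
case: (ex_minnP exD) => n /asboolP[I [idI sIU I0 dI]] minn.
exists I; split=> // K idK sKI; have [->|K0] := eqVneq K 0%VS; [by left|right].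
apply/eqP; rewrite eqEdim sKI dI minn //; apply/asboolP; exists K; split=> //.
exact: subv_trans sKI sIU.
Qed.

(** The orthogonal of I commutes with I and together with I spans g, so an ideal of I is
    an ideal of g. *)
Lemma minimal_ideal_simple I : lie_ideal fullv I -> (I <= S)%VS -> I != 0%VS ->
    (forall K, lie_ideal fullv K -> (K <= I)%VS -> K = 0%VS \/ K = I) ->
  simple_lie I.
Proof.
move=> idI sIS I0 minI; split.
  apply: contrapT => ab; case/eqP: I0; apply: abelian_ideal0 => // a b aI bI.
  by apply/eqP; apply: contrapT => /negP ab0; case: ab; exists a => //; exists b.
move=> K [sKI idK]; apply: minI => //; split=> [|x k _ kK]; first exact: subvf.
have kI := subvP sKI _ kK.
have [a aI xO] := killing_orth_split x idI sIS.
rewrite -(subrK a x) bracketDl; apply: memvD; last exact: idK.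
suff -> : ⁅x - a, k⁆ = 0 by rewrite mem0v.
apply/eqP; rewrite -memv0 -(killing_orth_cap idI sIS) memv_cap (ideal_r idI) //=.
exact: (ideal_l (killing_orth_ideal idI)).
Qed.

(** Split off a minimal ideal I and go on with its orthogonal in U. That the summands are
    ideals of g, and not only of U, makes them ideals at the next stage. *)
Lemma ideal_decomp U : lie_ideal fullv U -> (U <= S)%VS ->
  exists p (s : 'I_p -> {vspace g}),
    simple_decomp U s /\ forall i, lie_ideal fullv (s i).
Proof.
have [n] := ubnP (\dim U); elim: n U => // n IH U /ltnSE dU idU sUS.
have [->|U0] := eqVneq U 0%VS.
  exists 0%N, (fun=> 0%VS); split; last by case.
  split; [by case|by rewrite big_ord0|].
  by apply/directv_sumP => -[].
have [I [idI sIU I0 minI]] := minimal_ideal idU U0.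
have sIS := subv_trans sIU sUS.
have simI := minimal_ideal_simple idI sIS I0 minI.
pose V := (U :&: killing_orth I)%VS.
have idV : lie_ideal fullv V.
  split=> [|x a _]; first exact: subvf.
  rewrite !memv_cap => /andP[aU aO]; rewrite (ideal_r idU) //=.
  exact: (ideal_r (killing_orth_ideal idI)).
have IV0 : (I :&: V = 0)%VS.
  apply/eqP; rewrite -subv0 -(killing_orth_cap idI sIS).
  by rewrite capvS // capvSr.
have IVU : (I + V = U)%VS.
  apply/eqP; rewrite eqEsubv subv_add sIU capvSl /=; apply/subvP => u uU.
  have [a aI uO] := killing_orth_split u idI sIS.
  rewrite -(subrK a u) addrC memv_add // memv_cap uO andbT memvB //.
  exact: (subvP sIU).
have dIV : (\dim I + \dim V)%N = \dim U by rewrite -IVU dimv_disjoint_sum.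
have [|p [s [[s1 s2 s3] s4]]] := IH V _ idV (subv_trans (capvSl _ _) sUS).
  apply: leq_trans dU; rewrite -dIV -[X in (X < _)%N]add0n ltn_add2r.
  by rewrite lt0n dimv_eq0.
pose t (i : 'I_p.+1) := if unlift ord0 i is Some k then s k else I.
have t0 : t ord0 = I by rewrite /t unlift_none.
have tS k : t (lift ord0 k) = s k by rewrite /t liftK.
have tsum : (\sum_(i < p.+1) t i)%VS = U.
  by rewrite big_ord_recl t0 -[RHS]IVU -s2; congr addv; apply: eq_bigr => k _; rewrite tS.
have tid i : lie_ideal fullv (t i).
  by have [k ->|->] := unliftP ord0 i; rewrite ?tS ?t0.
exists p.+1, t; split=> //; split=> // [i|].
  split; first split; last 1 first.
  - by have [k ->|->] := unliftP ord0 i; rewrite ?tS ?t0 //; case: (s1 k).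
  - by rewrite -tsum (sumv_sup i).
  by move=> x a _; apply: ideal_r.
rewrite directvE /= tsum -dIV big_ord_recl /= t0 eqn_add2l.
move: s3; rewrite directvE /= s2 => /eqP->; apply/eqP/eq_bigr => k _.
by rewrite tS.
Qed.

End ReductiveIdeals.

Section ReductiveCentroid.
Variables (R : rcfType) (g : lieAlgType R).
Implicit Types (x y : g).

Notation Z := (center g).
Notation S := (lie_prod (@fullv R g) fullv).
Notation Zt := (subvs_of Z).
Notation zinc := (@zinc R g).
Notation zproj := (@zproj R g).

Hypothesis red : killing_reductive g.

(** An element of J is a scalar on each simple ideal and an arbitrary operator on Z; in
    the other direction, the projections onto the simple ideals commute with ad. *)
Lemma dim_Jspace p (s : 'I_p -> {vspace g}) :
    simple_decomp S s -> (forall i, ~ has_complex_structure (s i)) ->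
  \dim (Jspace g) = (p + \dim Z * \dim Z)%N.
Proof.
move=> [s_simp s_sum s_dir] nocx.
have s_id i : lie_ideal fullv (s i) by apply: derived_ideal; case: (s_simp i).
have s_sm i : simple_lie (s i) by case: (s_simp i).
pose pi i := (sumv_pi_for (esym s_sum) i \o (\1 - (zinc \o zproj)))%VF.
have pi_s i x : pi i x \in s i by rewrite comp_lfunE memv_sum_pi.
have pi_sum x : \sum_i pi i x = x - zinc (zproj x).
  rewrite -[RHS](sumv_pi_sum (esym s_sum)) ?sub_zproj_derived //.
  by apply: eq_bigr => i _; rewrite comp_lfunE add_lfunE opp_lfunE id_lfunE comp_lfunE.
have uniq (u v : 'I_p -> g) : (forall i, u i \in s i) -> (forall i, v i \in s i) ->
    \sum_i u i = \sum_i v i -> forall i, u i = v i.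
  move=> us vs /eqP; move/directv_sum_unique: s_dir => -> // /forallP uv i.
  exact/eqP/uv.
have pi_br i x y : pi i ⁅x, y⁆ = ⁅pi i x, y⁆.
  move: i; apply: uniq => [i|i|]; [exact: pi_s|exact: ideal_l|].
  rewrite pi_sum zproj_bracket // linear0 subr0.
  rewrite -[in LHS](subrK (zinc (zproj x)) x) bracketDl.
  rewrite [⁅zinc _, y⁆]center_l ?zinc_center // addr0 -pi_sum.
  apply: (big_morph (fun u => ⁅u, y⁆)) => [u v|].
    exact: bracketDl.
  exact: bracket0l.
have pi_zinc i z : pi i (zinc z) = 0.
  move: i; apply: uniq => [i|i|]; [exact: pi_s|exact: mem0v|].
  by rewrite pi_sum zprojK // subrr big1.
have pi_id i k u : u \in s i -> pi k u = if k == i then u else 0.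
  move=> us; move: k; apply: uniq => [k|k|]; first exact: pi_s.
    by case: eqP => [->//|_]; rewrite mem0v.
  have uS : u \in S by rewrite -s_sum; apply: (subvP (sumv_sup i _ (subvv _))).
  by rewrite pi_sum -big_mkcond big_pred1_eq zproj_derived // linear0 subr0.
clearbody pi.
pose T : vectType R := ('rV[R]_p * 'End(Zt))%type.
pose h (t : T) : 'End(g) := \sum_i t.1 0 i *: pi i + (zinc \o t.2 \o zproj)%VF.
have hE (t : T) x : h t x = \sum_i t.1 0 i *: pi i x + zinc (t.2 (zproj x)).
  rewrite add_lfunE sum_lfunE !comp_lfunE; congr (_ + _).
  by apply: eq_bigr => i _; rewrite scale_lfunE.
clearbody h.
have h_lin : linear h.
  move=> a u v; apply/lfunP => x; rewrite add_lfunE scale_lfunE !hE /=.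
  rewrite scalerDr addrACA; congr (_ + _).
    rewrite scaler_sumr -big_split; apply: eq_bigr => i _ /=.
    by rewrite !mxE scalerDl scalerA.
  by rewrite add_lfunE scale_lfunE linearP.
have -> : (p + \dim Z * \dim Z)%N = dim T.
  by rewrite -[RHS]/(1 * p + \dim Z * \dim Z)%N mul1n.
apply: (@dim_inj_img _ _ _ (linfun h)) => [[l w]|j].
  rewrite linfunE // => /lfunP h0.
  have w0 : w = 0.
    apply/lfunP => z; have := h0 (zinc z); rewrite hE /= zprojK // big1.
      by rewrite add0r !zero_lfunE => wz; rewrite -[w z](zprojK red) wz linear0.
    by move=> i _; rewrite pi_zinc scaler0.
  congr (_, _) => //; apply/rowP => i; rewrite mxE.
  have [[u us [v _ uv]] _] := s_sm i.
  have u0 : u != 0 by apply: contraNneq uv => ->; rewrite bracket0l.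
  have := h0 u; rewrite hE /= zero_lfunE w0 zero_lfunE linear0 addr0.
  rewrite (bigD1 i) //= (pi_id i i) // eqxx big1 ?addr0.
    by move/eqP; rewrite scaler_eq0 (negPf u0) orbF => /eqP.
  by move=> k /negPf ki; rewrite (pi_id i) // ki scaler0.
split=> [Jj|[t <-]]; last first.
  rewrite linfunE //; apply/mem_Jspace => x y; rewrite !hE.
  rewrite zproj_bracket // !linear0 addr0 bracketDl [⁅zinc _, y⁆]center_l ?zinc_center //.
  rewrite addr0 (big_morph (fun u => ⁅u, y⁆) (fun u v => bracketDl u v y) (bracket0l y)).
  by apply: eq_bigr => i _; rewrite pi_br bracketZl.
have [l lE] := fin_all_exists (fun i => centroid_scalar (s_sm i) (s_id i) (nocx i) Jj).
exists (\row_i l i, (zproj \o j \o zinc)%VF); rewrite linfunE //.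
apply/lfunP => x; rewrite hE /= !comp_lfunE zincK //; last first.
  apply/mem_center => y; move/mem_Jspace: Jj => <-.
  by rewrite center_l ?zinc_center ?linear0.
rewrite -[in RHS](subrK (zinc (zproj x)) x) linearD /=; congr (_ + _).
rewrite -pi_sum linear_sum; apply: eq_bigr => i _; rewrite mxE.
exact/esym/lE.
Qed.

End ReductiveCentroid.

Section InvariantForm.
Variables (F : fieldType) (g : lieAlgType F).

Notation Z := (center g).
Notation S := (lie_prod (@fullv F g) fullv).

(** If an invariant form is nondegenerate, x is orthogonal to [g, g] exactly when it
    is central, so the map from g to the dual of [g, g] has kernel Z. *)
Lemma center_derived_sum (b : 'Hom(g, dualv g)) :
    (forall x y z, b ⁅x, y⁆ z = b x ⁅y, z⁆) ->
    (forall x, b x = 0 -> x = 0) -> (Z :&: S = 0)%VS -> (Z + S = fullv)%VS.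
Proof.
move=> bA bnd ZS0.
pose r := linfun (fun x =>
  (b x \o linfun (vsval : subvs_of S -> g))%VF : dualv (subvs_of S)).
have rE x (a : subvs_of S) : r x a = b x (vsval a).
  rewrite /r linfunE ?comp_lfunE ?lfunE // => c v w.
  by rewrite linearP comp_lfunDl comp_lfunZl.
have kr : (lker r <= Z)%VS.
  apply/subvP => x; rewrite memv_ker => /eqP/lfunP rx; apply/mem_center => y.
  apply: bnd; apply/lfunP => z; rewrite bA zero_lfunE.
  by have := rx (Subvs (mem_derived y z)); rewrite rE zero_lfunE.
apply/eqP; rewrite eqEdim subvf dimv_disjoint_sum // -(limg_ker_dim r fullv) capfv.
rewrite leq_add ?dimvS //; apply: leq_trans (dimvS (subvf _)) _.
by rewrite dimvf dim_dual.
Qed.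

End InvariantForm.

(** * Compact algebras *)

Section Compact.
Variables (R : realType) (g : lieAlgType R).
Implicit Types (x y : g).

Notation Z := (center g).
Notation S := (lie_prod (@fullv R g) fullv).

Hypothesis cpt : compact_lie g.

Lemma compact_form : exists b : 'Hom(g, dualv g), 
  [/\ forall x y, b x y = b y x, forall x, x != 0 -> 0 < b x x :> R &
      forall x y z, b ⁅x, y⁆ z = b x ⁅y, z⁆].
Proof.
case: cpt => B [Blin Bsym Bpos Binv].
have bE0 x y : linfun (B x : g -> R^o) y = B x y.
  by rewrite linfunE // => a u v; apply: Blin.
pose b : 'Hom(g, dualv g) := linfun (fun x => linfun (B x : g -> R^o)).
have bE x y : b x y = B x y.
  rewrite /b linfunE ?bE0 // => a u v; apply/lfunP => w.
  by rewrite add_lfunE scale_lfunE !bE0 Bsym Blin !(Bsym w).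
exists b; split=> [x y|x x0|x y z]; [by rewrite !bE|by rewrite bE Bpos|].
rewrite bracketC linearN opp_lfunE !bE; apply/eqP.
by rewrite eq_sym -addr_eq0 addrC Binv.
Qed.

Section Form.
Variable b : 'Hom(g, dualv g).
Hypotheses (b_sym : forall x y, b x y = b y x)
  (b_pos : forall x, x != 0 -> 0 < b x x :> R)
  (b_inv : forall x y z, b ⁅x, y⁆ z = b x ⁅y, z⁆).

Lemma compact_center_derived : (Z :&: S = 0)%VS.
Proof.
apply/eqP; rewrite -subv0; apply/subvP => z; rewrite memv_cap memv0 => /andP[zZ zS].
have bz0 : b z z = 0.
  by apply: lfun_derived0 zS => x y; rewrite -b_inv center_l // linear0 zero_lfunE.
by apply: contraTT isT => /b_pos; rewrite bz0 ltxx.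
Qed.

(** Gram-Schmidt, in the form of the expansion that it provides. *)
Lemma orthonormal_seq (U : {vspace g}) : exists2 e : seq g, {subset e <= U} &
  {in U, forall v, v = \sum_(u <- e) b u v *: u}.
Proof.
have [n] := ubnP (\dim U); elim: n U => // n IH U /ltnSE dU.
have [->|U0] := eqVneq U 0%VS.
  by exists [::] => // v; rewrite memv0 big_nil => /eqP.
have v0 : vpick U != 0 by rewrite vpick0.
pose u := (Num.sqrt (b (vpick U) (vpick U)))^-1 *: vpick U.
have uU : u \in U by rewrite memvZ ?memv_pick.
have bu : b u u = 1.
  have b0 := b_pos v0.
  rewrite /u [b (_ *: _)]linearZ scale_lfunE [b _ (_ *: _)]linearZ [LHS]mulrA.
  rewrite -invfM -expr2 sqr_sqrtr ?ltW //.
  by rewrite [LHS]mulVf ?gt_eqF.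
clearbody u.
pose V := (U :&: lker (b u))%VS.
have [|e eV eE] := IH V.
  apply: leq_trans dU; rewrite ltnNge; apply/negP => dUV.
  have VU : V = U by apply/eqP; rewrite eqEdim capvSl.
  by move: uU; rewrite -VU memv_cap memv_ker bu oner_eq0 andbF.
exists (u :: e) => [v|w wU].
  by rewrite inE => /predU1P[->//|/eV]; rewrite memv_cap => /andP[].
have wV : w - b u w *: u \in V.
  rewrite memv_cap; apply/andP; split; first by apply: memvB => //; apply: memvZ.
  by rewrite memv_ker linearB linearZ /= bu [X in _ - X]mulr1 subrr.
rewrite big_cons -[LHS](subrK (b u w *: u)) addrC [in LHS](eE _ wV).
congr (_ + _); apply: eq_big_seq => v /eV; rewrite memv_cap memv_ker => /andP[_ /eqP vu].
by rewrite linearB linearZ /= (b_sym v u) vu scaler0 subr0.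
Qed.

(** As ad x is skew for b, the trace of its square is minus the sum of the b-norms of the
    [x, u], for u in an orthonormal basis. *)
Lemma compact_killing x :
  killing g x x <= 0 :> R /\ (killing g x x = 0 -> x \in Z).
Proof.
have [e _ eE] := orthonormal_seq fullv.
have kE : killing g x x = - \sum_(u <- e) b ⁅x, u⁆ ⁅x, u⁆.
  rewrite killingE.
  have -> : (ad g x \o ad g x)%VF =
      \sum_(u <- e) linfun (fun v => b u v *: ⁅x, ⁅x, u⁆⁆).
    apply/lfunP => v; rewrite sum_lfunE comp_lfunE !adE {1}(eE v) ?memvf //.
    rewrite !linear_sum; apply: eq_bigr => u _; rewrite !linearZ linfunE // => a v1 v2.
    by rewrite linearP scalerDl scalerA.
  rewrite [LHS]linear_sum -sumrN; apply: eq_bigr => u _.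
  rewrite [LHS](@lftrace_rank1 _ _ (b u) ⁅x, ⁅x, u⁆⁆).
    by apply: (etrans (esym (b_inv u x _))); rewrite (bracketC u) linearN opp_lfunE.
  by move=> v; rewrite linfunE // => a v1 v2; rewrite linearP scalerDl scalerA.
have b_ge0 v : 0 <= b v v :> R.
  by have [->|/b_pos/ltW//] := eqVneq v 0; rewrite linear0.
rewrite kE oppr_le0; split=> [|/eqP]; first by rewrite sumr_ge0.
rewrite oppr_eq0 psumr_eq0 // => /allP xe; apply/mem_center => v.
rewrite (eE v) ?memvf // linear_sum big_seq big1 // => u /xe /eqP bxu.
rewrite linearZ /=; suff -> : ⁅x, u⁆ = 0 by rewrite scaler0.
by apply: contraTeq isT => /b_pos; rewrite bxu ltxx.
Qed.

End Form.

Lemma compact_reductive : killing_reductive g.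
Proof.
have [b [b_sym b_pos b_inv]] := compact_form.
have ZS := compact_center_derived b_pos b_inv; split=> // [x kx|].
  by apply: (compact_killing b_sym b_pos b_inv x).2; rewrite kx zero_lfunE.
apply: center_derived_sum b_inv _ ZS => x bx; apply/eqP.
by apply: contraTT isT => /b_pos; rewrite bx zero_lfunE ltxx.
Qed.

(** On s, (ad cx)^2 = (c o ad x)^2 = - (ad x)^2, so k(cx, cx) = - k(x, x), while the
    Killing form is negative definite modulo Z. *)
Lemma compact_no_complex_structure (s : {vspace g}) : lie_ideal fullv s -> simple_lie s ->
  ~ has_complex_structure s.
Proof.
move=> ids [[x xs [y ys xy0]] _] [c [cs cbr]].
have [b [b_sym b_pos b_inv]] := compact_form.
have knP := compact_killing b_sym b_pos b_inv.
have trP u : u \in s -> killing g u u = lftrace ((ad g u \o ad g u) \o projv s)%VF.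
  move=> us; rewrite killingE [RHS]lftrace_comp; congr lftrace.
  by apply/lfunP => v; rewrite !comp_lfunE !adE projv_id // (ideal_l ids).
have kc : killing g (c x) (c x) = - killing g x x.
  rewrite !trP //; last by case: (cs x xs).
  rewrite -[RHS]linearN; congr lftrace; apply/lfunP => v.
  rewrite opp_lfunE !comp_lfunE !adE; set w := projv s v.
  have ws : w \in s by rewrite memv_proj.
  have us : ⁅x, w⁆ \in s by rewrite (ideal_l ids).
  have [cus _] := cs _ us.
  rewrite -!cbr // -[in RHS](cs _ _).2 ?(ideal_l ids) //; congr (c _).
  by rewrite bracketC -cbr // -linearN -bracketC.
case/eqP: xy0; apply: center_l; apply: (knP x).2; apply/eqP.
rewrite eq_le (knP x).1 /= -oppr_le0 -kc; exact: (knP _).1.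
Qed.

End Compact.

(** * Cartan's criterion *)

Section SemisimplePart.
Variable C : numClosedFieldType.

Lemma nilpotent_trace0 n (N : 'M[C]_n.+1) k : N ^+ k = 0 -> \tr N = 0.
Proof.
move=> Nk; have [rs] := closed_field_poly_normal (char_poly N).
rewrite (eqP (char_poly_monic N)) scale1r => chE.
have rs0 a : a \in rs -> a = 0.
  move=> ars; have : eigenvalue N a.
    by rewrite eigenvalue_root_char chE root_prod_XsubC.
  case/eigenvalueP => v vN v0.
  have vNk m : v *m N ^+ m = a ^+ m *: v.
    elim: m => [|m IH]; first by rewrite !expr0 mulmx1 scale1r.
    by rewrite exprSr mulmxA IH -scalemxAl vN scalerA -exprSr.
  have := vNk k; rewrite Nk mulmx0 => /esym/eqP.
  by rewrite scaler_eq0 (negPf v0) orbF expf_eq0 => /andP[_ /eqP].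
have chX : char_poly N = 'X^(size rs).
  rewrite chE (eq_big_seq (fun _ => 'X)); last by move=> a /rs0->; rewrite subr0.
  by rewrite big_const_seq count_predT -Monoid.iteropE.
have srs : size rs = n.+1.
  by apply: succn_inj; rewrite -(size_polyXn C) -chX size_char_poly.
have := char_poly_trace N (ltn0Sn n); rewrite chX srs coefXn /=.
by rewrite eqn_leq ltnn andbF => /esym/eqP; rewrite oppr_eq0 => /eqP.
Qed.

Lemma idempotent_trace n (P : 'M[C]_n) : P *m P = P -> \tr P = (\rank P)%:R.
Proof.
move=> PP; have E : row_base P *m col_base P = 1%:M.
  have /row_freeP[B RB] := row_base_free P.
  have /row_fullP[A AC] := col_base_full P.
  have LM : col_base P *m row_base P *m (col_base P *m row_base P) =
      col_base P *m row_base P by rewrite mulmx_base.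
  move: (col_base P) (row_base P) AC RB LM => L M AC RB LM.
  have := congr1 (fun M => A *m M *m B) LM.
  by rewrite /= !mulmxA AC mul1mx -!mulmxA RB mulmx1.
by rewrite -{1}(mulmx_base P) mxtrace_mulC E mxtrace1.
Qed.

Variables (n : nat) (X : 'M[C]_n.+1).

(** By Cayley-Hamilton, u is killed by (X - a)^m, for m the multiplicity of a as a root
    of the characteristic polynomial. *)
Lemma geigenspace_exp a k (u : 'rV_n.+1) : u *m (X - a%:M) ^+ k = 0 ->
  (u <= geigenspace X a)%MS /\ (~~ root (char_poly X) a -> u = 0).
Proof.
have horn m : horner_mx X (('X - a%:P) ^+ m) = (X - a%:M) ^+ m.
  by rewrite rmorphXn /= rmorphB /= horner_mx_X horner_mx_C.
move=> uk; have := multiplicity_XsubC (char_poly X) a.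
case=> m [q rq chE].
have ch0 : char_poly X != 0 := monic_neq0 (char_poly_monic X).
rewrite ch0 /= in rq.
have um : u *m (X - a%:M) ^+ m = 0.
  have : (u *m (X - a%:M) ^+ m <= kermxpoly X (('X - a%:P) ^+ k) :&: kermxpoly X q)%MS.
    rewrite sub_capmx; apply/andP; split; apply/sub_kermxP.
      by rewrite horn -mulmxA mulmxE -exprD addnC exprD -mulmxE mulmxA uk mul0mx.
    rewrite -horn -mulmxA mulmxE -rmorphM /= mulrC -chE.
    by rewrite Cayley_Hamilton mulmx0.
  rewrite (mxdirect_kermxpoly X) ?submx0 => [/eqP//|].
  by rewrite coprimep_expl // coprimep_sym coprimep_XsubC.
split.
  have mn : (m <= n.+1)%N.
    have := size_char_poly X; rewrite chE.
    have q0 : q != 0 by apply: contraNneq ch0 => q0; rewrite chE q0 mul0r.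
    rewrite size_proper_mul ?lead_coef_exp; last first.
      by rewrite lead_coefXsubC expr1n mulr1 lead_coef_eq0.
    rewrite size_exp_XsubC addnS /= => sq.
    have : (0 < size q)%N by rewrite size_poly_gt0.
    by case: (size q) sq => // s [<-] _; rewrite leq_addl.
  rewrite geigenspaceE; apply/sub_kermxP.
  have -> : (X - a%:M) ^+ n.+1 = (X - a%:M) ^+ m *m (X - a%:M) ^+ (n.+1 - m).
    by rewrite mulmxE -exprD subnKC.
  by rewrite mulmxA um mul0mx.
case: m chE um => [|m] chE um; first by rewrite expr0 mulmx1 in um.
by rewrite chE rootM root_exp_XsubC eqxx orbT.
Qed.

(** Y is the conjugate of the semisimple part of X: the conjugate of a on the generalized
    eigenspace of a. The trace of X Y is the sum of the |a|^2 counted with multiplicity,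
    and the last clause says that the generalized eigenspaces span. *)
Lemma conj_semisimple_part : exists Y : 'M[C]_n.+1,
  [/\ forall a k (u : 'rV_n.+1), u *m (X - a%:M) ^+ k = 0 -> u *m Y = a^* *: u,
      \tr (X *m Y) = 0 -> X ^+ n.+1 = 0 &
      forall P : 'rV[C]_n.+1 -> Prop, P 0 -> (forall u v, P u -> P v -> P (u + v)) ->
        (forall a k (u : 'rV_n.+1), u *m (X - a%:M) ^+ k = 0 -> P u) -> forall u, P u].
Proof.
have [rs] := closed_field_poly_normal (char_poly X).
rewrite (eqP (char_poly_monic X)) scale1r => chE.
pose ds := undup rs; pose I := 'I_(size ds).
pose a (i : I) := ds`_i; pose V (i : I) := geigenspace X (a i).
have root_a b : root (char_poly X) b -> exists i, b = a i.
  rewrite chE root_prod_XsubC -mem_undup => bds.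
  have ib : (index b ds < size ds)%N by rewrite index_mem.
  by exists (Ordinal ib); rewrite /a nth_index.
have a_root i : root (char_poly X) (a i).
  by rewrite chE root_prod_XsubC -mem_undup mem_nth.
have a_inj : injective a.
  by move=> i k /eqP; rewrite nth_uniq ?undup_uniq // => /eqP/val_inj.
have dirV := mxdirect_sum_geigenspace (P := predT) X (in2W a_inj).
have sumV : (\sum_i V i :=: (1 : 'M[C]_n.+1))%MS.
  apply: eqmx_trans (eqmx_sym (kermxpoly_prod X _)) _ => [i k _ _ ki|].
    by rewrite coprimep_expr ?coprimep_expl // coprimep_XsubC root_XsubC (inj_eq a_inj).
  apply: kermxpoly_min; apply: dvdp_trans (mxminpoly_dvd_char X) _.
  rewrite prodrXl chE; set Q := \prod_i _.
  have srs : size rs = n.+1.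
    by have := size_char_poly X; rewrite chE size_prod_XsubC => -[].
  rewrite -srs; have : forall b, b \in rs -> root Q b.
    move=> b brs; have [|i ->] := root_a b; first by rewrite chE root_prod_XsubC.
    by rewrite /Q (bigD1 i) //= rootM root_XsubC eqxx.
  elim: (rs) => [|b s IH] sQ; first by rewrite big_nil expr0.
  rewrite big_cons /= exprS dvdp_mul ?IH //; last by move=> x xs; rewrite sQ // inE xs orbT.
  by rewrite dvdp_XsubCl sQ // mem_head.
pose W i := (\sum_(k | k != i) V k)%MS.
have VW i : (V i :&: W i = 0)%MS by move/mxdirect_sumsP: dirV => /(_ i isT).
pose p i := proj_mx (V i) (W i).
pose Y := \sum_i (a i)^* *: p i.
have pid m i (A : 'M_(m, n.+1)) : (A <= V i)%MS -> A *m p i = A.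
  exact: proj_mx_id.
have pik m i k (A : 'M_(m, n.+1)) : k != i -> (A <= V k)%MS -> A *m p i = 0.
  by move=> ki AV; apply: proj_mx_0 => //; apply: submx_trans AV (sumsmx_sup k _ _).
have psub m i (A : 'M_(m, n.+1)) : (A *m p i <= V i)%MS by apply: proj_mx_sub.
have YV i (u : 'rV_n.+1) : (u <= V i)%MS -> u *m Y = (a i)^* *: u.
  move=> uV; rewrite mulmx_sumr (bigD1 i) //= -scalemxAr pid // big1 ?addr0 // => k ki.
  by rewrite -scalemxAr (pik _ k i) ?scaler0 // eq_sym.
exists Y; split=> [b k u /geigenspace_exp[uV nr]|trY|P P0 PD PV u].
- have [/root_a[i bE]|/nr ->] := boolP (root (char_poly X) b).
    by rewrite bE (YV i) // /V -bE.
  by rewrite mul0mx scaler0.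
- suff a0 i : a i = 0.
    have rs0 b : b \in rs -> b = 0.
      by move=> brs; have [|i ->//] := root_a b; rewrite chE root_prod_XsubC.
    have <- : horner_mx X 'X^(n.+1) = X ^+ n.+1 by rewrite rmorphXn /= horner_mx_X.
    rewrite -(Cayley_Hamilton X); congr (horner_mx X _).
    rewrite chE (eq_big_seq (fun _ => 'X)); last by move=> x /rs0->; rewrite subr0.
    have srs : size rs = n.+1.
      by have := size_char_poly X; rewrite chE size_prod_XsubC => -[].
    by rewrite big_const_seq count_predT -Monoid.iteropE srs.
  have trp k : \tr (X *m p k) = a k * (\rank (p k))%:R.
    rewrite mxtrace_mulC -idempotent_trace; last by rewrite pid // -[p k]mul1mx psub.
    pose N := p k *m (X - (a k)%:M).
    have pV : (p k <= V k)%MS by rewrite -[p k]mul1mx psub.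
    have Vst (A : 'M_n.+1) : (A <= V k)%MS -> (A *m (X - (a k)%:M) <= V k)%MS.
      move=> AV; apply: submx_trans (submxMr _ AV) _.
      apply: comm_mx_stable_geigenspace; rewrite /comm_mx mulmxBr mulmxBl.
      by rewrite scalar_mxC.
    have pVm m : (p k *m (X - (a k)%:M) ^+ m <= V k)%MS.
      by elim: m => [|m IH]; rewrite ?expr0 ?mulmx1 // exprSr -mulmxE mulmxA Vst.
    have Nm m : N ^+ m.+1 = p k *m (X - (a k)%:M) ^+ m.+1.
      elim: m => [|m IH]; first by rewrite !expr1.
      by rewrite exprSr IH -mulmxE mulmxA pid // (exprSr _ m.+1) -mulmxE mulmxA.
    have N0 : N ^+ n.+1 = 0.
      by rewrite Nm; apply/sub_kermxP; rewrite -geigenspaceE.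
    have := nilpotent_trace0 N0; rewrite /N mulmxBr raddfB /= => /eqP.
    by rewrite subr_eq0 => /eqP->; rewrite mul_mx_scalar mxtraceZ.
  have p0 k : (0 < \rank (p k))%N.
    rewrite lt0n mxrank_eq0; apply/eqP => pk0.
    have : eigenvalue X (a k) by rewrite eigenvalue_root_char.
    case/eigenvalueP => v vX v0; case/eqP: v0.
    rewrite -(pid _ k v) ?pk0 ?mulmx0 //.
    apply: submx_trans (eigenspace_sub_geigen X (a k)); exact/eigenspaceP.
  move: trY; rewrite mulmx_sumr raddf_sum /=.
  rewrite (eq_bigr (fun k => (a k)^* * a k * (\rank (p k))%:R)); last first.
    by move=> k _; rewrite -scalemxAr mxtraceZ trp mulrA.
  have ge0 k : true -> 0 <= (a k)^* * a k * (\rank (p k))%:R.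
    by rewrite mulr_ge0 ?ler0n // mulrC mul_conjC_ge0.
  move/eqP; rewrite psumr_eq0 // => /allP/(_ i (mem_index_enum i)) /=.
  rewrite mulf_eq0 pnatr_eq0 -leqn0 leqNgt p0 orbF mulrC mul_conjC_eq0.
  by move/eqP.
have : (u <= \sum_i V i)%MS by rewrite sumV submx1.
case/sub_sumsmxP => w ->; apply: (big_ind P) => // i _.
apply: (PV (a i) n.+1); rewrite -mulmxA; set A := V i *m _.
suff -> : A = 0 by rewrite mulmx0.
by apply/sub_kermxP; rewrite -geigenspaceE.
Qed.
End SemisimplePart.

Section Coordinates.
Variables (F : fieldType) (V : vectType F) (n : nat) (e : n.-tuple V).
Hypothesis eb : basis_of fullv e.

Definition row_of (v : V) : 'rV[F]_n := \row_k coord e k v.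
Definition mx_of (f : 'End(V)) : 'M[F]_n := \matrix_(i, k) coord e k (f e`_i).

Fact row_of_linear : linear row_of.
Proof. by move=> a u v; apply/rowP => k; rewrite !mxE linearP. Qed.
HB.instance Definition _ := GRing.isLinear.Build F V 'rV_n _ row_of row_of_linear.

Fact mx_of_linear : linear mx_of.
Proof.
by move=> a f h; apply/matrixP => i k; rewrite !mxE add_lfunE scale_lfunE linearP.
Qed.
HB.instance Definition _ := GRing.isLinear.Build F 'End(V) 'M_n _ mx_of mx_of_linear.

Lemma row_of_eq0 v : row_of v = 0 -> v = 0.
Proof.
move=> /rowP r0; rewrite (coord_basis eb (memvf v)) big1 // => k _.
by have := r0 k; rewrite !mxE => ->; rewrite scale0r.
Qed.

Lemma row_of_app (f : 'End(V)) v : row_of (f v) = row_of v *m mx_of f.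
Proof.
apply/rowP => k; rewrite !mxE {1}(coord_basis eb (memvf v)) !linear_sum /=.
by apply: eq_bigr => i _; rewrite !linearZ /= !mxE.
Qed.

Lemma mx_of_comp (f h : 'End(V)) : mx_of (f \o h) = mx_of h *m mx_of f.
Proof.
apply/row_matrixP => i; have E q : row i (mx_of q) = row_of (q e`_i).
  by apply/rowP => k; rewrite !mxE.
by rewrite row_mul !E comp_lfunE row_of_app.
Qed.

Lemma lftrace_mx_of (f : 'End(V)) : lftrace f = \tr (mx_of f).
Proof.
have lin i : linear (fun v => coord e i v *: f e`_i).
  by move=> a u v; rewrite linearP scalerDl scalerA.
have -> : f = \sum_(i < n) linfun (fun v => coord e i v *: f e`_i).
  apply/lfunP => v; rewrite sum_lfunE [in LHS](coord_basis eb (memvf v)) linear_sum.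
  by apply: eq_bigr => i _; rewrite linearZ linfunE.
rewrite !raddf_sum /=; apply: eq_bigr => i _.
rewrite (@lftrace_rank1 _ _ (linfun (coord e i : V -> F^o)) (f e`_i)); last first.
  by move=> v; rewrite !linfunE // => a u w; rewrite linearP.
rewrite lfunE /= /mxtrace (bigD1 i) //= big1 ?addr0 => [|k /negPf ki].
  by rewrite mxE linfunE // (coord_free _ _ (basis_free eb)) eqxx scale1r.
by rewrite mxE linfunE // (coord_free _ _ (basis_free eb)) ki scale0r linear0.
Qed.

End Coordinates.

Section AdNilpotent.
Variables (R : rcfType) (g : lieAlgType R) (n : nat) (e : n.+1.-tuple g).
Hypothesis eb : basis_of fullv e.
Implicit Types (x y : g).
Local Notation C := (complex R).
Local Notation rc := (real_complex R).

Definition complex_ad x : 'M[C]_n.+1 := map_mx rc (mx_of e (ad g x)).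
Local Notation A := complex_ad.

(** The operator ad u of the complexified algebra, u being a row of coordinates. *)
Definition complex_ad_row (u : 'rV[C]_n.+1) : 'M[C]_n.+1 := \sum_k u 0 k *: A e`_k.
Local Notation adC := complex_ad_row.

Fact complex_ad_row_linear : linear adC.
Proof.
move=> a u v; rewrite /adC scaler_sumr -big_split; apply: eq_bigr => k _ /=.
by rewrite !mxE scalerDl scalerA.
Qed.
HB.instance Definition _ := GRing.isLinear.Build C _ _ _ adC complex_ad_row_linear.

Lemma complex_adE x : A x = adC (map_mx rc (row_of e x)).
Proof.
rewrite /A {1}(coord_basis eb (memvf x)) !linear_sum raddf_sum.
apply: eq_bigr => k _; rewrite !linearZ /= map_mxZ; congr (_ *: _).
by rewrite !mxE.
Qed.

Lemma complex_ad_bracket x y : A ⁅x, y⁆ = A y *m A x - A x *m A y.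
Proof.
by rewrite /A ad_bracketE raddfB /= !(mx_of_comp eb) // map_mxB !map_mxM.
Qed.

Lemma complex_ad_derivation x u : adC u *m A x = adC (u *m A x) + A x *m adC u.
Proof.
have -> : adC (u *m A x) = \sum_k u 0 k *: A ⁅x, e`_k⁆.
  rewrite /adC (eq_bigr (fun j => \sum_k (u 0 k * A x k j) *: A e`_j)); last first.
    by move=> j _; rewrite mxE scaler_suml.
  rewrite exchange_big; apply: eq_bigr => k _; rewrite (complex_adE ⁅x, _⁆) scaler_sumr.
  by apply: eq_bigr => j _; rewrite scalerA !mxE adE.
rewrite mulmx_suml mulmx_sumr -big_split; apply: eq_bigr => k _ /=.
by rewrite -scalemxAl -scalemxAr -scalerDr complex_ad_bracket subrK.
Qed.

(** The Leibniz rule sends a product of generalized eigenvectors for a and b to a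
    generalized eigenvector for a + b. *)
Lemma complex_ad_geigen x a b k l (u v : 'rV[C]_n.+1) :
    u *m (A x - a%:M) ^+ k = 0 -> v *m (A x - b%:M) ^+ l = 0 ->
  (v *m adC u) *m (A x - (a + b)%:M) ^+ (k + l) = 0.
Proof.
move em: (k + l)%N => m; elim: m k l u v em => [|m IH] k l u v.
  move/eqP; rewrite addn_eq0 => /andP[/eqP-> _]; rewrite expr0 mulmx1 => -> _.
  by rewrite linear0 mulmx0 mul0mx.
case: k => [|k].
  by move=> _; rewrite expr0 mulmx1 => ->; rewrite linear0 mulmx0 mul0mx.
case: l => [|l]; first by move=> _ _; rewrite expr0 mulmx1 => ->; rewrite !mul0mx.
rewrite addSn => -[klm] uk vl.
have -> : v *m adC u *m (A x - (a + b)%:M) ^+ m.+1 =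
    (v *m adC (u *m (A x - a%:M)) + (v *m (A x - b%:M)) *m adC u)
      *m (A x - (a + b)%:M) ^+ m.
  rewrite exprS -mulmxE mulmxA; congr (_ *m _).
  rewrite !mulmxBr mulmxBl !mul_mx_scalar -[v *m adC u *m A x]mulmxA complex_ad_derivation.
  rewrite [adC (_ - _)]linearB /= [adC (_ *: _)]linearZ /= mulmxDr mulmxBr !mulmxA.
  rewrite scalerDl -scalemxAl -scalemxAr.
  by rewrite opprD addrACA.
rewrite mulmxDl (IH k l.+1) ?(IH k.+1 l) ?addr0 //.
- by rewrite addSnnS.
- by rewrite -mulmxA mulmxE -exprS.
by rewrite -mulmxA mulmxE -exprS.
Qed.

(** Y is a derivation of the complexification, so for c, d in I the trace of ad [c, d] Y is
    minus the Killing form of c and Y d, that is, zero. By linearity this holds for every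
    element of [I, I], in particular for x, from which Y is built. *)
Lemma ad_nilpotent (I : {vspace g}) x : (I <= lker (killing g))%VS ->
  x \in lie_prod I I -> exists k, forall v, iter k (bracket x) v = 0.
Proof.
move=> sIk xI.
have [Y [Y1 Y2 Y3]] := conj_semisimple_part (A x).
have BY u (v : 'rV_n.+1) : v *m adC u *m Y = v *m adC (u *m Y) + (v *m Y) *m adC u.
  move: u v; apply: (Y3 (fun u => forall v : 'rV_n.+1, v *m adC u *m Y =
    v *m adC (u *m Y) + (v *m Y) *m adC u)) => [v|u u' uP u'P v|a k u uk v].
  - by rewrite mul0mx linear0 !(mulmx0, mul0mx) addr0.
  - rewrite mulmxDl ![adC (_ + _)]linearD /= !mulmxDr mulmxDl uP u'P; exact: addrACA.
  move: v. apply: (Y3 (fun v => v *m adC u *m Y =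
    v *m adC (u *m Y) + (v *m Y) *m adC u)) => [|v v' vP v'P|b l v vl].
  - by rewrite !mul0mx addr0.
  - by rewrite !mulmxDl vP v'P; exact: addrACA.
  rewrite (Y1 _ _ _ (complex_ad_geigen uk vl)) (Y1 _ _ _ uk) (Y1 _ _ _ vl).
  by rewrite linearZ /= -scalemxAl -scalemxAr -scalerDl rmorphD.
have AY d : A d *m Y = adC (map_mx rc (row_of e d) *m Y) + Y *m A d.
  apply/row_matrixP => i; rewrite !rowE mulmxDr !mulmxA complex_adE BY.
  by [].
have trY : \tr (A x *m Y) = 0.
  pose P z := \tr (A z *m Y) = 0.
  have memP := @mem_vspace_of _ _ P.
  have P0 : P 0 by rewrite /P /A !linear0 map_mx0 mul0mx mxtrace0.
  have PD (a : R) u v : P u -> P v -> P (a *: u + v).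
    rewrite /P /A => uP vP.
    by rewrite !linearP map_mxD map_mxZ mulmxDl -scalemxAl linearP /= uP vP mulr0 addr0.
  suff /subvP/(_ x xI)/(memP P0 PD) : (lie_prod I I <= vspace_of P)%VS by [].
  apply: lie_prod_sub => c d cI dI.
  apply/(memP P0 PD); rewrite /P complex_ad_bracket mulmxBl raddfB /=.
  rewrite -mulmxA mxtrace_mulC -!mulmxA AY mulmxDr raddfD /= opprD addrCA subrr addr0.
  apply/eqP; rewrite oppr_eq0; apply/eqP; rewrite /adC mulmx_sumr linear_sum big1 // => k _.
  rewrite /= -scalemxAr mxtraceZ -map_mxM trace_map_mx -mx_of_comp // -lftrace_mx_of //.
  have /(subvP sIk) := cI; rewrite memv_ker -killingE killingC => /eqP->.
  by rewrite zero_lfunE rmorph0 mulr0.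
exists n.+1 => v; have Xn := Y2 trY.
have it k : row_of e (iter k (bracket x) v) = row_of e v *m (mx_of e (ad g x)) ^+ k.
  elim: k => [|k IH]; first by rewrite expr0 mulmx1.
  by rewrite iterS -adE row_of_app // IH exprSr -mulmxE mulmxA.
apply: (row_of_eq0 eb); rewrite it.
suff -> : mx_of e (ad g x) ^+ n.+1 = 0 by rewrite mulmx0.
apply/eqP; rewrite -(map_mx_eq0 rc) rmorphXn; apply/eqP; exact: Xn.
Qed.

End AdNilpotent.

Section Engel.
Variables (F : fieldType) (g : lieAlgType F).
Implicit Types (x y : g) (M U V : {vspace g}).

(** Engel's theorem for the action of M on V/U, stated without quotients so that the
    induction on dim M can apply it both to (N, M) and to (U, V), where N is a maximal
    proper subalgebra of M. The first yields w normalizing N with M = N + <w>; the second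
    yields vectors killed by N modulo U, which w preserves, and w is nilpotent on them. *)
Lemma engel M U V :
    {in M &, forall x y, ⁅x, y⁆ \in M} ->
    {in M, forall x, exists k, forall v, iter k (bracket x) v = 0} ->
    (U <= V)%VS -> U != V ->
    {in M & U, forall x u, ⁅x, u⁆ \in U} -> {in M & V, forall x u, ⁅x, u⁆ \in V} ->
  exists v, [/\ v \in V, v \notin U & {in M, forall x, ⁅x, v⁆ \in U}].
Proof.
have [d] := ubnP (\dim M); elim: d M U V => // d IH M U V /ltnSE dM.
move=> Malg Mnil sUV UV MU MV.
have exv (W W' : {vspace g}) : (W <= W')%VS -> W != W' -> exists2 v, v \in W' & v \notin W.
  by move=> sW nW; apply/subvPn; apply: contra nW => sW'; rewrite eqEsubv sW.
have [M0|M0] := eqVneq M 0%VS.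
  have [v vV vU] := exv _ _ sUV UV; exists v; split=> // x.
  by rewrite M0 memv0 => /eqP->; rewrite bracket0l mem0v.
pose D := [pred m | `[< exists N : {vspace g}, [/\ (N <= M)%VS, N != M,
  {in N &, forall x y, ⁅x, y⁆ \in N} & \dim N = m] >]].
have exD : exists m, D m.
  exists 0%N; apply/asboolP; exists 0%VS; split; rewrite ?sub0v ?dimv0 1?eq_sym //.
  by move=> x y; rewrite memv0 => /eqP-> _; rewrite bracket0l mem0v.
have Dle m : D m -> (m <= \dim M)%N.
  by move=> /asboolP[N [sNM _ _ <-]]; apply: dimvS.
case: (ex_maxnP exD Dle) => m /asboolP[N [sNM NM Nalg dN]] maxN.
have ltN : (\dim N < d)%N.
  apply: leq_trans dM; rewrite ltnNge; apply: contra NM => dMN.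
  by rewrite eqEdim sNM.
have Nnil : {in N, forall x, exists k, forall v, iter k (bracket x) v = 0}.
  by move=> x /(subvP sNM)/Mnil.
have [|w [wM wN Nw]] := IH N N M ltN Nalg Nnil sNM NM Nalg.
  by move=> x u /(subvP sNM) xM uM; apply: Malg.
have ME : (N + <[w]>)%VS = M.
  apply/eqP; apply: contraT => NwM.
  have : D (\dim (N + <[w]>)).
    apply/asboolP; exists (N + <[w]>)%VS; split=> //.
      by rewrite subv_add sNM -memvE.
    move=> _ _ /memv_addP[x xN [_ /vlineP[a ->] ->]] /memv_addP[y yN [_ /vlineP[b ->] ->]].
    rewrite bracketDl !bracketDr !bracketZl !bracketZr bracketxx !scaler0 addr0.
    apply: (subvP (addvSl _ _)); apply: memvD.
      by apply: memvD; [exact: Nalg|rewrite memvZ ?Nw].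
    by rewrite memvZ // bracketC memvN Nw.
  move/maxN; rewrite -dN => le; case/negP: wN; rewrite memvE.
  suff <- : (N + <[w]>)%VS = N by apply: addvSr.
  by apply/esym/eqP; rewrite eqEdim addvSl.
pose V0 := vspace_of (fun v => v \in V /\ {in N, forall x, ⁅x, v⁆ \in U}).
have V0P v : v \in V0 <-> v \in V /\ {in N, forall x, ⁅x, v⁆ \in U}.
  apply: (@mem_vspace_of _ _ (fun v => v \in V /\ {in N, forall x, ⁅x, v⁆ \in U})).
    by split=> [|x _]; rewrite ?linear0 mem0v.
  move=> a u u' [uV uU] [u'V u'U]; split=> [|x xN]; first by rewrite memvD ?memvZ.
  by rewrite linearP memvD ?memvZ ?uU ?u'U.
have [||v0 [v0V v0U v0N]] := IH N U V ltN Nalg Nnil sUV UV.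
- by move=> x u /(subvP sNM) xM uU; apply: MU.
- by move=> x u /(subvP sNM) xM uU; apply: MV.
have w_V0 v : v \in V0 -> ⁅w, v⁆ \in V0.
  move=> /V0P[vV vN]; apply/V0P; split=> [|x xN]; first exact: MV.
  have -> : ⁅x, ⁅w, v⁆⁆ = ⁅⁅x, w⁆, v⁆ + ⁅w, ⁅x, v⁆⁆ by rewrite bracketA subrK.
  by rewrite memvD ?vN ?Nw // MU // vN.
have itV0 k : iter k (bracket w) v0 \in V0.
  by elim: k => [|k]; [apply/V0P|apply: w_V0].
have exk : exists k, iter k (bracket w) v0 \in U.
  by have [k wk] := Mnil w wM; exists k; rewrite wk mem0v.
case: (ex_minnP exk) => -[|k] kU mink; first by rewrite kU in v0U.
exists (iter k (bracket w) v0); have /V0P[vV vN] := itV0 k; split=> //.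
  by apply/negP => /mink; rewrite ltnn.
move=> x; rewrite -ME => /memv_addP[y yN [_ /vlineP[a ->] ->]].
by rewrite bracketDl bracketZl memvD ?vN ?memvZ.
Qed.

(** For a maximal proper M-stable subspace U of M, Engel's theorem gives v with [M, v] in
    U and M = U + <v>; hence [M, M] lies in U. *)
Lemma perfect_nilpotent0 M : {in M &, forall x y, ⁅x, y⁆ \in M} ->
    {in M, forall x, exists k, forall v, iter k (bracket x) v = 0} ->
  (M <= lie_prod M M)%VS -> M = 0%VS.
Proof.
move=> Malg Mnil Mperf; apply/eqP; apply: contraT => M0.
pose D := [pred m | `[< exists U : {vspace g}, [/\ (U <= M)%VS, U != M,
  {in M & U, forall x y, ⁅x, y⁆ \in U} & \dim U = m] >]].
have exD : exists m, D m.
  exists 0%N; apply/asboolP; exists 0%VS; split; rewrite ?sub0v ?dimv0 1?eq_sym //.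
  by move=> x y _; rewrite memv0 => /eqP->; rewrite linear0 mem0v.
have Dle m : D m -> (m <= \dim M)%N.
  by move=> /asboolP[N [sNM _ _ <-]]; apply: dimvS.
case: (ex_maxnP exD Dle) => m /asboolP[U [sUM UM MU dU]] maxU.
have [v [vM vU Mv]] := engel Malg Mnil sUM UM MU Malg.
have stab : {in M & (U + <[v]>)%VS, forall x y, ⁅x, y⁆ \in U}.
  move=> x _ xM /memv_addP[y yU [_ /vlineP[b ->] ->]].
  by rewrite bracketDr bracketZr; apply: memvD; [exact: MU|rewrite memvZ ?Mv].
have ME : (U + <[v]>)%VS = M.
  apply/eqP; apply: contraT => NwM.
  have : D (\dim (U + <[v]>)).
    apply/asboolP; exists (U + <[v]>)%VS; split=> //.
      by rewrite subv_add sUM -memvE.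
    by move=> x y xM yU; apply: (subvP (addvSl _ _)); apply: stab.
  move/maxU; rewrite -dU => le; case/negP: vU; rewrite memvE.
  suff <- : (U + <[v]>)%VS = U by apply: addvSr.
  by apply/esym/eqP; rewrite eqEdim addvSl.
rewrite ME in stab; case/negP: UM; rewrite eqEsubv sUM /=.
exact: subv_trans Mperf (lie_prod_sub stab).
Qed.

End Engel.

(** Cartan's criterion, by a minimal ideal I in the radical of the Killing form: [I, I]
    is zero or I, and I is solvable in the first case. *)
Lemma semisimple_killing (R : rcfType) (g : lieAlgType R) x :
  semisimple g -> killing g x = 0 -> x = 0.
Proof.
move=> ss kx; apply/eqP; rewrite -memv0.
suff <- : lker (killing g) = 0%VS by rewrite memv_ker kx.
apply/eqP; apply: contraT => N0.
have idN : lie_ideal fullv (lker (killing g)).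
  split=> [|u a _]; first exact: subvf.
  rewrite !memv_ker => /eqP ka; apply/eqP.
  by rewrite killing_coad ka linear0.
have [I [idI sIN I0 minI]] := minimal_ideal idN N0.
have sII : (lie_prod I I <= I)%VS by apply: lie_prod_sub => a b _ bI; apply: ideal_r.
have idII : lie_ideal fullv (lie_prod I I).
  split=> [|u a _ aI]; first exact: subvf.
  have : (lie_prod I I <= ad g u @^-1: lie_prod I I)%VS.
    apply: lie_prod_sub => b c bI cI; rewrite -memv_preim adE.
    have -> : ⁅u, ⁅b, c⁆⁆ = ⁅⁅u, b⁆, c⁆ + ⁅b, ⁅u, c⁆⁆ by rewrite bracketA subrK.
    by rewrite memvD ?mem_lie_prod // ideal_r.
  by move/subvP/(_ a aI); rewrite -memv_preim adE.
case: (minI _ idII sII) => [II0|IIE].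
  by rewrite (ss I idI) ?eqxx // in I0; exists 1%N.
case/eqP: I0; apply: perfect_nilpotent0; last by rewrite IIE.
  by move=> a b _ bI; apply: ideal_r.
have dg : exists n, \dim {:g} = n.+1.
  have : (0 < \dim {:g})%N.
    by apply: leq_trans (dimvS (subvf (lker (killing g)))); rewrite lt0n dimv_eq0.
  by case: (\dim {:g}) => // n _; exists n.
(* Square matrices form a ring only in a dimension of the form n.+1. *)
have [n dn] := dg; pose e := tcast dn (vbasis {:g}).
have eb : basis_of fullv e by rewrite /e val_tcast vbasisP.
by move=> a aI; apply: (ad_nilpotent eb sIN); rewrite IIE.
Qed.

Lemma semisimple_center (F : fieldType) (g : lieAlgType F) :
  semisimple g -> center g = 0%VS.
Proof.
move=> ss; apply: ss; first split; first exact: subvf.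
  by move=> x z _ zZ; rewrite center_r // mem0v.
exists 1%N => /=; apply/eqP; rewrite -subv0; apply: lie_prod_sub => x y xZ _.
by rewrite center_l // mem0v.
Qed.

Lemma semisimple_reductive (R : realType) (g : lieAlgType R) :
  semisimple g -> killing_reductive g.
Proof.
move=> ss; have Z0 := semisimple_center ss; split.
- by move=> x /(semisimple_killing ss)->; rewrite mem0v.
- apply: (@center_derived_sum _ _ (killing g)) => [x y z|x|].
  + exact: killingA.
  + exact: semisimple_killing.
  by rewrite Z0 cap0v.
by rewrite Z0 cap0v.
Qed.

Theorem theoremC (R : realType) (g : lieAlgType R) :
  let H1D := H1 (ad_rep (cotangent_lie g)) in
  H1D ≅ (H1 (ad_rep g) * subvs_of (Jtspace g) * H1 (coad_rep g)
         * subvs_of (Psispace g))%type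
  /\ (semisimple g ->
      [/\ Psispace g = 0%VS,
          H1D ≅ subvs_of (Jtspace g),
          exists p (s : 'I_p -> {vspace g}), simple_decomp fullv s
        & forall p (s : 'I_p -> {vspace g}), simple_decomp fullv s ->
            (forall i, ~ has_complex_structure (s i)) ->
            subvs_of (Jspace g) ≅ 'rV[R]_p /\ H1D ≅ 'rV[R]_p])
  /\ (compact_lie g ->
      let Z := subvs_of (center g) in
      let k := \dim (center g) in
      let EndRk := 'End('rV[R]_k) in
      let derived := lie_prod (@fullv R g) fullv in
      [/\ H1 (ad_rep g) ≅ 'End(Z),
          H1 (coad_rep g) ≅ 'Hom(Z, dualv Z),
          subvs_of (Psispace g) ≅ 'Hom(dualv Z, Z),
          exists p (s : 'I_p -> {vspace g}), simple_decomp derived s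
        & forall p (s : 'I_p -> {vspace g}), simple_decomp derived s ->
            subvs_of (Jspace g) ≅ ('rV[R]_p * 'End(Z))%type
            /\ H1D ≅ (EndRk * EndRk * EndRk * EndRk * 'rV[R]_p)%type]).
Proof.
move=> H1D.
have two_neq0 : 2%:R != 0 :> R by rewrite pnatr_eq0.
have dimHom (V W : vectType R) : dim 'Hom(V, W) = (dim V * dim W)%N by [].
have dimPair (V W : vectType R) : dim (V * W)%type = (dim V + dim W)%N by [].
have dimSub (V : vectType R) (U : {vspace V}) : dim (subvs_of U) = \dim U by [].
have dimRow (n : nat) : dim 'rV[R]_n = n by exact: (mul1n n).
have dimH := dimH1_cotangent g.
split; first exact: vs_iso_dim.
have decomp (red : killing_reductive g) : exists p (s : 'I_p -> {vspace g}),
    simple_decomp (lie_prod fullv fullv) s.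
  have [||p [s [sP _]]] := ideal_decomp red (U := lie_prod fullv fullv).
  - by split=> [|x y _ _]; [exact: subvf|exact: mem_derived].
  - exact: subvv.
  by exists p, s.
split=> [ss|cpt Z k EndRk derived].
  have red := semisimple_reductive ss.
  have Z0 := semisimple_center ss.
  have S1 : lie_prod fullv fullv = fullv :> {vspace g}.
    by have [_ + _] := red; rewrite Z0 add0v.
  have Psi0 : \dim (Psispace g) = 0%N by rewrite dim_Psispace // Z0 dimv0.
  have dH : dim H1D = \dim (Jspace g).
    by rewrite dimH dimH1_ad // dimH1_coad // Psi0 Z0 dimv0 !addn0 dim_Jtspace.
  rewrite S1 in decomp.
  split; [by apply/eqP; rewrite -dimv_eq0 Psi0| |exact: decomp|].
    by apply: vs_iso_dim; rewrite dH -dim_Jtspace.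
  move=> p s sP nocx; have dJ : \dim (Jspace g) = p.
    by rewrite (dim_Jspace red (s := s)) ?S1 // Z0 dimv0 muln0 addn0.
  by split; apply: vs_iso_dim; rewrite dimRow ?dH.
have red := compact_reductive cpt.
split; rewrite /Z.
- by apply: vs_iso_dim; rewrite dimH1_ad // dimHom.
- by apply: vs_iso_dim; rewrite dimH1_coad // dimHom dim_dual.
- by apply: vs_iso_dim; rewrite dimSub dim_Psispace // dimHom dim_dual.
- exact: decomp.
move=> p s sP.
have dJ : \dim (Jspace g) = (p + k * k)%N.
  rewrite (dim_Jspace red sP) // => i; have [s1 _ _] := sP; have [id sm] := s1 i.
  by apply: compact_no_complex_structure => //; apply: derived_ideal.
split; apply: vs_iso_dim; first by rewrite dimSub dJ dimPair dimRow dimHom.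
rewrite !dimPair !dimHom !dimRow dimH dimH1_ad // dimH1_coad // dim_Psispace //.
rewrite dim_Jtspace dJ -/k.
by rewrite (AC (1*2*1*1) (1*3*4*5*2)).
Qed.
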